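(* Let $T$ be an algebraic virtual tangle, and let $K$ be the virtual link diagram obtained from $T$ by vertical closure or by horizontal closure. If $K$ is a knot (that is, its underlying $1$-manifold is a single circle), then $K$ is wink-equivalent to the unknot (the crossingless diagram of one circle).
   Context: **Diagrams.** A virtual diagram (or simply diagram) is the image of a proper smooth immersion of a $1$-manifold (a disjoint union of finitely many circles and intervals) into a disk, whose singularities are transverse double points, each labelled as a classical crossing (with over/under information) or a virtual crossing. Proper means that the boundary of the $1$-manifold is mapped to the boundary of the disk. Diagrams are unoriented. **Welded isotopy.** The equivalence relation on diagrams generated by ambient isotopies of the disk fixing the boundary pointwise and the local moves: classical Reidemeister moves I, II, III; virtual Reidemeister moves I, II, III (the same moves with all crossings virtual); the mixed Reidemeister move (a strand meeting two other strands only in virtual crossings may be moved across a classical crossing of these two strands); the (OC)-move (a strand passing over two other strands, via two classical crossings, may be moved across a virtual crossing of these two strands). **Wink-move.** In a disk with boundary points TL, BL (left) and TR, BR (right), let $\ell$ be an arc joining TL to BL and bulging to the right, and $r$ an arc joining TR to BR and bulging to the left, so that $\ell$ and $r$ meet in exactly two points, an upper one and a lower one, bounding a bigon. One of these two points is a virtual crossing, and the other is a classical crossing at which $r$ passes over $\ell$ (two possibilities, according to whether the classical crossing is the upper or the lower one). Call this configuration $K$. Let $cK$ be the configuration obtained by inserting on the left of $K$ one classical crossing $c$ (of either of the two types) between the two left ends of $\ell$, so that $\ell$ acquires one self-crossing. The wink-moves are the local moves $cK \leftrightarrow K$ (up to planar isotopy and rotation). All versions generate, with welded isotopy, the same equivalence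 relation. Wink-equivalence is the equivalence relation on diagrams generated by welded isotopy and wink-moves. **Tangles.** A virtual tangle is a virtual diagram in $[0,1]^2$ whose underlying $1$-manifold consists of two intervals and finitely many circles, the endpoints of the intervals lying at the four corners of the square. The vertical stacking $T_1\circledcirc T_2$ places $T_1$ on top of $T_2$, gluing the bottom corners of $T_1$ to the top corners of $T_2$; the horizontal stacking $T_1\ominus T_2$ places $T_1$ to the left of $T_2$, gluing the right corners of $T_1$ to the left corners of $T_2$ (followed by rescaling to the unit square). The elementary tangles are $\sigma$, $\overline\sigma$, $\rho$, each consisting of the two diagonals of the square meeting in a single crossing: in $\sigma$ the crossing is classical with the bottom-left to top-right diagonal over; $\overline\sigma$ is obtained from $\sigma$ by exchanging over and under; in $\rho$ the crossing is virtual. An algebraic virtual tangle is any virtual tangle generated from $\sigma,\overline\sigma,\rho$ by the two stacking operations. **Closures.** The vertical closure joins, by disjoint crossingless arcs outside the square, the top-left corner to the bottom-left corner and the top-right corner to the bottom-right corner; the horizontal closure similarly joins top-left to top-right and bottom-left to bottom-right. *)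

(* Defs.v *)
From mathcomp Require Import all_boot.
From Stdlib Require Import Relation_Operators.

Set Implicit Arguments.
Unset Strict Implicit.
Unset Printing Implicit Defensive.

(* Virtual diagrams are encoded by sweeping the disk, seen as a rectangle, from
   top to bottom.  After a small planar isotopy the height function is Morse on
   the immersed 1-manifold, and each thin horizontal slice contains exactly one
   local maximum, local minimum or crossing next to vertical strands.  A diagram
   with n endpoints on the top edge and m on the bottom edge is the resulting
   list of slices, and ambient isotopy rel boundary becomes the relation
   generated by [isotopy] below. *)

(* [Classical true] is the classical crossing whose overstrand is the
   bottom-left to top-right diagonal; in [Classical false] it is the other
   diagonal. *)
Inductive crossing := Classical of bool | Virtual.

(* Exchanges over and under; this is also the rotation by a quarter turn. *)
Definition flip (c : crossing) : crossing :=
  if c is Classical b then Classical (~~ b) else Virtual.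

(* [Cap] is a local maximum, [Cup] a local minimum. *)
Inductive piece := Cap | Cup | Cross of crossing.

Definition ntop (g : piece) : nat := if g is Cap then 0 else 2.
Definition nbot (g : piece) : nat := if g is Cup then 0 else 2.

(* [(i, g)] is the slice with [g] placed to the right of i vertical strands. *)
Definition slice : Type := nat * piece.

Definition shift (k : nat) (w : seq slice) : seq slice :=
  [seq (k + x.1, x.2) | x <- w].

(* Number of strands at the bottom of [w] when there are n at the top, or
   [None] if some slice does not fit. *)
Fixpoint width (n : nat) (w : seq slice) : option nat :=
  if w is (i, g) :: w' then
    if i + ntop g <= n then width (n - ntop g + nbot g) w' else None
  else Some n.

Record diagram (n m : nat) := Diagram {
  slices :> seq slice;
  slicesP : width n slices == Some m }.

(* [isotopy p a b]: a and b are isotopic rel boundary in a rectangle with p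
   endpoints on top.  Besides exchanging the heights of two distant pieces,
   these are the creation or cancellation of a pair of extrema and the passage
   of an extremum through a crossing. *)
Inductive isotopy : nat -> seq slice -> seq slice -> Prop :=
| IsoExchange (g h : piece) (k : nat) :
    isotopy (ntop g + k + ntop h)
      [:: (0, g); (nbot g + k, h)] [:: (ntop g + k, h); (0, g)]
| IsoZigzag :
    isotopy 1 [:: (0, Cap); (1, Cup)] [::]
| IsoZagzig :
    isotopy 1 [:: (1, Cap); (0, Cup)] [::]
| IsoCap (c : crossing) :
    isotopy 1 [:: (0, Cap); (1, Cross c)] [:: (1, Cap); (0, Cross (flip c))]
| IsoCup (c : crossing) :
    isotopy 3 [:: (0, Cross c); (1, Cup)] [:: (1, Cross (flip c)); (0, Cup)].

(* Crossings of three strands 1, 2, 3, numbered from left to right at the top,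
   for which a strand may be moved across the crossing of the two others:
   [triangle x y z] means that 1 and 2 meet at x, 1 and 3 at y, 2 and 3 at z.
   When i < j, strand j is over strand i at [Classical true], and strand i is
   over strand j at [Classical false]. *)
Inductive triangle : crossing -> crossing -> crossing -> Prop :=
(* The two excluded patterns have no top strand: 1 over 2 over 3 over 1, and
   3 over 2 over 1 over 3. *)
| ClassicalIII (x y z : bool) : x = y \/ y = z ->
    triangle (Classical x) (Classical y) (Classical z)
| VirtualIII : triangle Virtual Virtual Virtual
| Mixed1 (z : bool) : triangle Virtual Virtual (Classical z)
| Mixed2 (y : bool) : triangle Virtual (Classical y) Virtual
| Mixed3 (x : bool) : triangle (Classical x) Virtual Virtual
(* OCi: strand i is over the two others. *)
| OC1 : triangle (Classical false) (Classical false) Virtual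
| OC2 : triangle (Classical true) Virtual (Classical false)
| OC3 : triangle Virtual (Classical true) (Classical true).

(* The rotated versions of these moves follow from [isotopy], by bending the
   strands with caps and cups.  In [WeldedI] and [WeldedII] the crossing is
   classical or virtual, which gives both kinds of Reidemeister moves. *)
Inductive welded_move : nat -> seq slice -> seq slice -> Prop :=
| WeldedI (c : crossing) :
    welded_move 1 [:: (1, Cap); (0, Cross c); (1, Cup)] [::]
| WeldedII (c : crossing) :
    welded_move 2 [:: (0, Cross c); (0, Cross (flip c))] [::]
| WeldedIII (x y z : crossing) : triangle x y z ->
    welded_move 3 [:: (0, Cross x); (1, Cross y); (0, Cross z)]
                  [:: (1, Cross z); (0, Cross y); (1, Cross x)].

Definition hstack_slices (S T : seq slice) : seq slice :=
  [:: (1, Cap)] ++ S ++ shift 2 T ++ [:: (1, Cup)].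

(* The overstrand of the classical crossing runs from the top right endpoint to
   the bottom right endpoint. *)
Inductive wink_config : seq slice -> Prop :=
| WinkUpper : wink_config [:: (0, Cross (Classical true)); (0, Cross Virtual)]
| WinkLower : wink_config [:: (0, Cross Virtual); (0, Cross (Classical false))].

Inductive wink_move : nat -> seq slice -> seq slice -> Prop :=
| Wink (c : bool) (K : seq slice) : wink_config K ->
    wink_move 2 (hstack_slices [:: (0, Cross (Classical c))] K) K.

(* [M] applied inside a sub-rectangle of a diagram with n endpoints on top. *)
Inductive local (M : nat -> seq slice -> seq slice -> Prop) (n : nat) :
    seq slice -> seq slice -> Prop :=
| Local (u v a b : seq slice) (i p N : nat) :
    M p a b -> width n u = Some N -> i + p <= N ->
    local M n (u ++ shift i a ++ v) (u ++ shift i b ++ v).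

Definition welded_step (n m : nat) (D E : diagram n m) : Prop :=
  local isotopy n D E \/ local welded_move n D E.

Definition wink_step (n m : nat) (D E : diagram n m) : Prop :=
  welded_step D E \/ local wink_move n D E.

Definition wink_equivalent (n m : nat) : diagram n m -> diagram n m -> Prop :=
  clos_refl_sym_trans (diagram n m) (@wink_step n m).

(* The underlying 1-manifold, cut along the horizontal lines between slices:
   [(k, s)] is the s-th point (from the left) of the line above slice k, and
   [slice_arc] relates the two endpoints of each arc contained in a slice. *)
Definition is_point (n m : nat) (D : diagram n m) (x : nat * nat) : Prop :=
  x.1 <= size D /\ exists2 N, width n (take x.1 D) = Some N & x.2 < N.

Inductive slice_arc (w : seq slice) : nat * nat -> nat * nat -> Prop :=
| ArcLeft k i g s : onth w k = Some (i, g) -> s < i ->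
    slice_arc w (k, s) (k.+1, s)
| ArcRight k i g s : onth w k = Some (i, g) ->
    slice_arc w (k, i + ntop g + s) (k.+1, i + nbot g + s)
| ArcCap k i : onth w k = Some (i, Cap) -> slice_arc w (k.+1, i) (k.+1, i.+1)
| ArcCup k i : onth w k = Some (i, Cup) -> slice_arc w (k, i) (k, i.+1)
| ArcFall k i c : onth w k = Some (i, Cross c) -> slice_arc w (k, i) (k.+1, i.+1)
| ArcRise k i c : onth w k = Some (i, Cross c) -> slice_arc w (k, i.+1) (k.+1, i).

(* Without endpoints every component of the 1-manifold is a circle, so it is a
   single circle when it is nonempty and connected. *)
Definition is_knot (D : diagram 0 0) : Prop :=
  (exists x, is_point D x) /\
  (forall x y, is_point D x -> is_point D y ->
     clos_refl_sym_trans (nat * nat) (slice_arc D) x y).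

Lemma width_cat n u v : width n (u ++ v) = obind (fun N => width N v) (width n u).
Proof. by elim: u n => [|[i g] u IHu] n //=; case: ifP. Qed.

Lemma width_shift k l n m w :
  width n w = Some m -> width (k + n + l) (shift k w) = Some (k + m + l).
Proof.
elim: w n => [|[i g] w IHw] n /=; first by case=> ->.
case: ifP => // le_n /IHw <-.
have le_g : ntop g <= n := leq_trans (leq_addl _ _) le_n.
rewrite -addnA -addnA leq_add2l (leq_trans le_n (leq_addr _ _)).
by congr width; rewrite -addnBA ?(leq_trans le_g (leq_addr _ _)) // -addnBAC //
  -!addnA [l + _]addnC.
Qed.

Definition virtual_tangle : Type := diagram 2 2.

Definition elementary (c : crossing) : virtual_tangle :=
  @Diagram 2 2 [:: (0, Cross c)] isT.

Definition sigma : virtual_tangle := elementary (Classical true).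
Definition sigma_bar : virtual_tangle := elementary (Classical false).
Definition rho : virtual_tangle := elementary Virtual.

Lemma vstackP (S T : virtual_tangle) : width 2 (S ++ T) == Some 2.
Proof. by rewrite width_cat (eqP (slicesP S)) /= slicesP. Qed.

Definition vstack (S T : virtual_tangle) : virtual_tangle :=
  Diagram (vstackP S T).

Lemma hstackP (S T : virtual_tangle) : width 2 (hstack_slices S T) == Some 2.
Proof.
have S_ok := width_shift 0 2 (eqP (slicesP S)).
have T_ok := width_shift 2 0 (eqP (slicesP T)).
have shift0 w : shift 0 w = w by elim: w => [|[i g] w /= ->].
by move: S_ok T_ok; rewrite shift0 /= width_cat => -> /=; rewrite width_cat => ->.
Qed.

Definition hstack (S T : virtual_tangle) : virtual_tangle :=
  Diagram (hstackP S T).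

Inductive algebraic : virtual_tangle -> Prop :=
| AlgSigma : algebraic sigma
| AlgSigmaBar : algebraic sigma_bar
| AlgRho : algebraic rho
| AlgVstack S T : algebraic S -> algebraic T -> algebraic (vstack S T)
| AlgHstack S T : algebraic S -> algebraic T -> algebraic (hstack S T).

Definition vclosure_slices (T : seq slice) : seq slice :=
  [:: (0, Cap); (2, Cap)] ++ shift 1 T ++ [:: (2, Cup); (0, Cup)].

Lemma vclosureP (T : virtual_tangle) : width 0 (vclosure_slices T) == Some 0.
Proof.
have T_ok := width_shift 1 1 (eqP (slicesP T)).
by move: T_ok; rewrite /= width_cat => ->.
Qed.

Definition vclosure (T : virtual_tangle) : diagram 0 0 :=
  Diagram (vclosureP T).

Definition hclosure_slices (T : seq slice) : seq slice :=
  [:: (0, Cap)] ++ T ++ [:: (0, Cup)].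

Lemma hclosureP (T : virtual_tangle) : width 0 (hclosure_slices T) == Some 0.
Proof. by rewrite /= width_cat (eqP (slicesP T)). Qed.

Definition hclosure (T : virtual_tangle) : diagram 0 0 :=
  Diagram (hclosureP T).

Definition unknot : diagram 0 0 := @Diagram 0 0 [:: (0, Cap); (0, Cup)] isT.

(* Main.v *)
Require Import Defs.
From mathcomp Require Import all_boot.
From mathcomp Require Import zify.
From Stdlib Require Import Relation_Operators.
From Stdlib Require Import FunctionalExtensionality PropExtensionality ProofIrrelevance.

Set Implicit Arguments.
Unset Strict Implicit.
Unset Printing Implicit Defensive.

(** A tangle is bent so that its four corners become legs pointing down, in the
    order TL, BL, BR, TR; crossings of neighbouring legs then act on tangles
    through the welded braid group.  Let e be the bent trivial vertical tangle
    and k, k' the braids in which one middle leg passes once over the other.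
    The wink-move says that a classical crossing of the legs TL, BL fixes
    e k and e k^-1.  The diagram with arrows from TL to BR and from TR to BL can
    be read from the left and from the right; comparing both readings gives
    k k' = k'^-1 k^-1 for all signs, and then that such a crossing also fixes
    every e k^n.  So each pure braid is some k^n k'^m, a crossing stacked to its
    left or right yields again a pure braid, and a braid that exchanges its
    strands is also the quarter turn of a braid.  By induction an algebraic
    tangle without closed components is a braid or the quarter turn of one, and
    the closure of a braid that joins its top ends unravels by first
    Reidemeister moves.  A tangle with a closed component, or closed in the
    wrong direction, admits a non-constant colouring of its components, so its
    closure is not a knot. *)

(** * Algebra of the crossings acting on bent tangles *)

Section PureBraids.
Variable X : Type.
Implicit Types (h : crossing -> X -> X) (F G : bool -> X -> X).

Definition commuting (f g : X -> X) := forall x, f (g x) = g (f x).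

Lemma commutingC f g : commuting f g -> commuting g f.
Proof. by move=> fg x; rewrite fg. Qed.

Lemma commuting_inv f f' g :
  cancel f f' -> cancel f' f -> commuting f g -> commuting f' g.
Proof. by move=> fK f'K fg x; rewrite -{1}(f'K x) -fg fK. Qed.

(** A map that commutes with an invertible map commutes with its inverse, so positive signs
    suffice. *)
Lemma commuting_signed F G :
  (forall b, cancel (F b) (F (~~ b))) -> (forall b, cancel (G b) (G (~~ b))) ->
  commuting (F true) (G true) -> forall a b, commuting (F a) (G b).
Proof.
move=> FK GK FG.
have FG' a : commuting (F a) (G true).
  by case: a => //; apply: commuting_inv FG; [exact: (FK true) | exact: (FK false)].
case=> -[]; first exact: FG'.
- by apply: commutingC; apply: commuting_inv (commutingC FG);
    [exact: (GK true) | exact: (GK false)].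
- exact: FG'.
- by apply: commutingC; apply: commuting_inv (commutingC (FG' false));
    [exact: (GK true) | exact: (GK false)].
Qed.

(* [h c] appends a crossing c of two given neighbouring legs.  In [rl h b] the
   right leg passes over the left one and comes back virtually, in [lr h b] the
   left leg passes over the right one; b is the sign.  [rl] is the configuration
   K of the wink-moves. *)
Definition rl h (b : bool) (x : X) : X :=
  if b then h Virtual (h (Classical true) x) else h (Classical false) (h Virtual x).
Definition lr h (b : bool) (x : X) : X :=
  if b then h (Classical true) (h Virtual x) else h Virtual (h (Classical false) x).

Arguments rl : simpl never.
Arguments lr : simpl never.

(* A reflection in a vertical line exchanges the two classical crossings, so the
   letters of a reflected picture are those of the original one up to [flip]. *)
Definition mirror h (c : crossing) : X -> X := h (flip c).

Lemma flipK : involutive flip.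
Proof. by case=> // b /=; rewrite negbK. Qed.

Lemma rl_mirror h b x : rl (mirror h) b x = lr h (~~ b) x.
Proof. by case: b. Qed.

Lemma lr_mirror h b x : lr (mirror h) b x = rl h (~~ b) x.
Proof. by case: b. Qed.

(* Lists of signs replace integer exponents. *)
Definition power F (l : seq bool) (x : X) : X := foldl (fun y b => F b y) x l.

Lemma power_rcons F l b x : power F (rcons l b) x = F b (power F l x).
Proof. by rewrite /power -cats1 foldl_cat. Qed.

Lemma power_cons F l b x : power F (b :: l) x = power F l (F b x).
Proof. by []. Qed.

Lemma commuting_power F g l :
  (forall b, commuting (F b) g) -> commuting (power F l) g.
Proof. by move=> Fg; elim: l => //= b l IHl x; rewrite /= Fg IHl. Qed.

(** [F true] and [F false] are mutually inverse, so all letters commute and the first one may be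
    applied last. *)
Lemma power_rconsC F l b x :
  (forall a, cancel (F a) (F (~~ a))) -> power F (b :: l) x = F b (power F l x).
Proof.
move=> FK; have FF a c : commuting (F a) (F c).
  by apply: (commuting_signed FK FK) => y.
by rewrite power_cons (commuting_power l (fun a => FF a b)).
Qed.

Lemma eq_power F G l x : (forall b y, F b y = G b y) -> power F l x = power G l x.
Proof. by move=> FG; elim: l x => //= b l IHl x; rewrite FG IHl. Qed.

Lemma power_neg F l x : power F (map negb l) x = power (fun b => F (~~ b)) l x.
Proof. by elim: l x => //= b l IHl x; rewrite IHl. Qed.

Lemma map_negbK (l : seq bool) : map negb (map negb l) = l.
Proof. by elim: l => //= b l ->; rewrite negbK. Qed.

Record braided (h1 h2 : crossing -> X -> X) : Prop := Braided {
  letterK1 : forall c, cancel (h1 c) (h1 (flip c));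
  letterK2 : forall c, cancel (h2 c) (h2 (flip c));
  triangleE : forall c1 c2 c3, triangle c1 c2 c3 ->
    forall x, h1 c3 (h2 c2 (h1 c1 x)) = h2 c1 (h1 c2 (h2 c3 x)) }.

(* In e the legs 1 and 2 are joined by a cap, which the leg 3 can pass by. *)
Record capped (h1 h2 : crossing -> X -> X) (e : X) : Prop := Capped {
  capE : forall c, h1 c e = e;
  slideE : forall c, h1 c (h2 c e) = h1 Virtual (h2 Virtual e) }.

Lemma rlK h : (forall c, cancel (h c) (h (flip c))) ->
  forall b, cancel (rl h b) (rl h (~~ b)).
Proof.
move=> hK; case=> x; rewrite /rl /=; first by rewrite (hK Virtual) (hK (Classical true)).
by rewrite (hK (Classical false)) (hK Virtual).
Qed.

Lemma lrK h : (forall c, cancel (h c) (h (flip c))) ->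
  forall b, cancel (lr h b) (lr h (~~ b)).
Proof.
move=> hK; case=> x; rewrite /lr /=; first by rewrite (hK (Classical true)) (hK Virtual).
by rewrite (hK Virtual) (hK (Classical false)).
Qed.

Lemma triangle_flip c1 c2 c3 :
  triangle c1 c2 c3 -> triangle (flip c3) (flip c2) (flip c1).
Proof. by case=> /= *; constructor; firstorder congruence. Qed.

Lemma braided_mirror h1 h2 : braided h1 h2 -> braided (mirror h2) (mirror h1).
Proof.
case=> K1 K2 tri; split=> [c|c|c1 c2 c3 /triangle_flip t x]; rewrite /mirror //.
by rewrite (tri _ _ _ t).
Qed.

(** * Three legs and one cap *)

Section Half.
Variables (h1 h2 : crossing -> X -> X).
Hypothesis br : braided h1 h2.

Local Notation k := (rl h2).
Local Notation k' := (lr h2).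
Local Notation q := (lr h1).
Local Notation V1 := (h1 Virtual).
Local Notation V2 := (h2 Virtual).

Let K1 := letterK1 br.
Let K2 := letterK2 br.
Let VK1 : involutive V1 := K1 Virtual.
Let VK2 : involutive V2 := K2 Virtual.

Lemma mixed12 c x : h1 c (V2 (V1 x)) = V2 (V1 (h2 c x)).
Proof.
have t : triangle Virtual Virtual c by case: c => [b|]; constructor.
exact: (triangleE br t).
Qed.

Lemma mixed21 c x : V1 (V2 (h1 c x)) = h2 c (V1 (V2 x)).
Proof.
have t : triangle c Virtual Virtual by case: c => [b|]; constructor.
exact: (triangleE br t).
Qed.

(** Both sides are a crossing c of the legs 1 and 3; leg 2 is avoided virtually on one side or the
    other. *)
Lemma detour c x : V1 (h2 c (V1 x)) = V2 (h1 c (V2 x)).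
Proof.
by rewrite -[RHS]VK1 mixed21 !VK2.
Qed.

(* The leg 1 passes over the leg 3. *)
Definition q13 b x := V2 (q b (V2 x)).

Lemma qK b : cancel (q b) (q (~~ b)).
Proof. exact: lrK. Qed.

Lemma q13K b : cancel (q13 b) (q13 (~~ b)).
Proof. by move=> x; rewrite /q13 VK2 qK VK2. Qed.

Lemma q13E b x : q13 b x = V1 (k' b (V1 x)).
Proof.
case: b; rewrite /q13 /lr.
  by rewrite -[V2 (V1 x)]VK1 detour (mixed12 Virtual) VK2.
by rewrite -[h2 _ (V1 x)]VK1 (detour (Classical false)) (mixed12 Virtual) VK2.
Qed.

(** The strand in third position passes over the two others, so it may be moved across their
    crossing c: by Reidemeister III if c is classical, by (OC) if it is virtual. *)
Lemma over_two_back c x :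
  h1 (Classical true) (h2 (Classical true) (h1 c x)) =
  h2 c (h1 (Classical true) (h2 (Classical true) x)).
Proof.
have t : triangle c (Classical true) (Classical true).
  by case: c => [b|]; constructor; right.
exact: (triangleE br t).
Qed.

Lemma q_q13_true x : q true (q13 true x) =
  h1 (Classical true) (h2 (Classical true) (V2 (V1 x))).
Proof. by rewrite q13E /lr VK1. Qed.

(* The leg 1 passes over the legs 2 and 3, hence over their crossings. *)
Lemma q_q13_commuting_true c : commuting (q true \o q13 true) (h2 c).
Proof. by move=> x /=; rewrite !q_q13_true -mixed12 over_two_back. Qed.

(** Conjugation by [V2] exchanges [q] and [q13]. Since it fixes their product, the two factors
    commute. *)
Lemma q_q13C a b : commuting (q a) (q13 b).
Proof.
apply: (commuting_signed qK q13K) => x.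
by have := q_q13_commuting_true Virtual (V2 x); rewrite /= /q13 !VK2.
Qed.

Lemma q_q13_commuting b c : commuting (q b \o q13 b) (h2 c).
Proof.
case: b; first exact: q_q13_commuting_true.
apply: commuting_inv (q_q13_commuting_true c) => x /=.
  by rewrite q_q13C (qK true) (q13K true).
by rewrite q_q13C (qK false) (q13K false).
Qed.

Lemma rl_q_q13 a b : commuting (k a) (q b \o q13 b).
Proof. by move=> x; case: a; rewrite /rl /lr -!(q_q13_commuting b _ _). Qed.

Lemma lr_q_q13 a b : commuting (k' a) (q b \o q13 b).
Proof. by move=> x; case: a; rewrite /rl /lr -!(q_q13_commuting b _ _). Qed.

(** Leg 3 passes over leg 1 in one factor and over leg 2 in the other. By [d] the product is a
    single passage over both legs, and this is unchanged under conjugation by [V1], which reverses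
    the order of the factors. *)
Lemma rl_rl13 a b : commuting (fun x => V1 (k a (V1 x))) (k b).
Proof.
have d x : V1 (k true (V1 (k true x))) =
    V2 (V1 (h1 (Classical true) (h2 (Classical true) x))).
  by rewrite /rl -mixed21 mixed12 VK2.
have kK := rlK K2.
pose k13 b x := V1 (k b (V1 x)).
have k13K c : cancel (k13 c) (k13 (~~ c)) by move=> x; rewrite /k13 VK1 kK VK1.
apply: (commuting_signed k13K kK) => x; rewrite /k13.
by rewrite d -[in RHS](VK1 x) -[k true (V1 _)]VK1 d over_two_back -mixed12 VK1 VK1.
Qed.

Variable e : X.
Hypothesis cap : capped h1 h2 e.

Let capV c : h1 c e = e := capE cap c.

Let e' := V1 (V2 e).

Let slide c : h2 c e = h1 (flip c) e'.
Proof. by rewrite /e' -(slideE cap c) K1. Qed.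

Let e'V c : h2 c e' = e'.
Proof. by rewrite /e' -mixed21 capV. Qed.

(** As [V1] fixes [e], the left side is [e] with leg 3 passing over leg 1. Sliding leg 3 past the
    cap moves the passage to the other foot and reverses its sign. *)
Lemma cap_rl b : V1 (k b e) = k (~~ b) e.
Proof.
have cap_true : V1 (k true e) = k false e by rewrite /rl !slide mixed21 e'V.
by case: b; rewrite // -[in RHS](VK1 (k _ e)) cap_true.
Qed.

Lemma cap_lr b : V1 (k' b e) = k' (~~ b) e.
Proof.
have cap_true : V1 (k' true e) = k' false e by rewrite /lr !slide detour e'V.
by case: b; rewrite // -[in RHS](VK1 (k' _ e)) cap_true.
Qed.

Lemma q13_cap b : q13 b e = k' (~~ b) e.
Proof. by rewrite q13E capV cap_lr. Qed.

Lemma q_cap b : q b e = e.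
Proof. by case: b; rewrite /lr !capV. Qed.

Lemma q_q13_cap b : q b (q13 b e) = k' (~~ b) e.
Proof. by rewrite q_q13C q_cap q13_cap. Qed.

(** After conjugation by [V1] the last letter commutes with the others ([rl_rl13]), hence can be
    moved next to [e], where [cap_rl] applies. *)
Lemma cap_power_rl l : V1 (power k l e) = power k (map negb l) e.
Proof.
elim/last_ind: l => [|l b IHl]; first exact: capV.
rewrite map_rcons power_rcons -[power k l e]VK1 IHl power_rcons.
rewrite -(commuting_power (g := fun x => V1 (k b (V1 x)))); last first.
  by move=> a x; rewrite rl_rl13.
by rewrite capV cap_rl -power_cons (power_rconsC _ _ _ (rlK K2)).
Qed.

End Half.

(** * The orbit of a capped state under pure braids *)

Section Orbit.
Variables (h1 h2 : crossing -> X -> X) (e : X).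
Hypotheses (br : braided h1 h2) (cap : capped h1 h2 e).

Local Notation k := (rl h2).
Local Notation k' := (lr h2).
Local Notation q := (lr h1).
Local Notation q13 := (q13 h1 h2).
Local Notation V1 := (h1 Virtual).

Hypothesis klein :
  forall b c x, k b (k' c x) = k' (~~ c) (k (~~ b) x).
Hypothesis cap_power_lr :
  forall m, V1 (power k' m e) = power k' (map negb m) e.
Hypothesis q_power_rl :
  forall b l, q b (power k l e) = power k (map negb l) e.

(* By [klein] this is the orbit of e under the pure braids on the legs 2 and 3. *)
Definition pure_orbit x := exists l m, x = power k' m (power k l e).

Let d b x := q b (q13 b x).

(** Every letter of [q] inverts a power of [k] on [e], so only the parity of the length of m
    matters. *)
Let negs (m l : seq bool) := iter (size m) (map negb) l.

Let negsK m : involutive (negs m).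
Proof.
move=> l; rewrite /negs -iterD addnn; elim: (size m) => // n IHn.
by rewrite doubleS !iterS IHn map_negbK.
Qed.

Let q_power_negs m l : power q m (power k l e) = power k (negs m l) e.
Proof.
elim/last_ind: m => // m b IHm.
by rewrite power_rcons IHm q_power_rl /negs size_rcons.
Qed.

Let d_power m x : power d m x = power q13 m (power q m x).
Proof.
elim/last_ind: m => // m b IHm; rewrite !power_rcons IHm /d.
rewrite (q_q13C br) -(commuting_power (g := q b)) // => a.
exact/commutingC/(q_q13C br).
Qed.

Let d_power_orbit m l :
  power d m (power k (negs m l) e) = power q13 m (power k l e).
Proof. by rewrite d_power q_power_negs negsK. Qed.

Let d_rl b a : commuting (k a) (d b) := rl_q_q13 br a b.

Let klein_power c l x :
  k' c (power k l x) = power k (map negb l) (k' (iter (size l) negb c) x).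
Proof.
elim/last_ind: l c => // l b IHl c.
rewrite power_rcons map_rcons power_rcons size_rcons iterSr.
have -> y : k' c (k b y) = k (~~ b) (k' (~~ c) y) by rewrite klein !negbK.
by rewrite IHl.
Qed.

Let pure_orbit_rl b x : pure_orbit x -> pure_orbit (k b x).
Proof.
case=> l [m ->]; elim/last_ind: m b => [|m c IHm] b.
  by exists (rcons l b), [::]; rewrite power_rcons.
rewrite power_rcons klein; have [l' [m' ->]] := IHm (~~ b).
by exists l', (rcons m' (~~ c)); rewrite power_rcons.
Qed.

Let pure_orbit_power_rl l x : pure_orbit x -> pure_orbit (power k l x).
Proof. by elim: l x => //= b l IHl x Ox; apply/IHl/pure_orbit_rl. Qed.

Let q13_power x m : V1 (power q13 m x) = power k' m (V1 x).
Proof.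
elim/last_ind: m => // m b IHm; rewrite !power_rcons (q13E br) -IHm.
by rewrite (letterK1 br Virtual).
Qed.

Let q13_power_cap m : power q13 m e = power k' (map negb m) e.
Proof.
rewrite -cap_power_lr -{2}(capE cap Virtual) -q13_power.
by rewrite (letterK1 br Virtual).
Qed.

Let rl_power_d l m : commuting (power k l) (power d m).
Proof.
apply: commuting_power => b; apply: commutingC; apply: commuting_power => a.
exact/commutingC/d_rl.
Qed.

(** Replacing [q13] by [d] costs only signs in the power of [k], and [d] commutes with [k]. Next to
    [e] the factor [q] of [d] disappears and [q13] becomes an inverse [k']. *)
Lemma pure_orbit_q13 l m : pure_orbit (power q13 m (power k l e)).
Proof.
rewrite -d_power_orbit -rl_power_d d_power (q_power_negs m [::]) /=.
have -> : negs m [::] = [::] by rewrite /negs; elim: (size m) => //= n ->.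
rewrite q13_power_cap; apply: pure_orbit_power_rl.
by exists [::], (map negb m).
Qed.

(** It is enough to use letters [d]. These commute with [k'], so a new [k' c] moves past them and
    then, by [klein_power], past the power of [k] to [e], where [q_q13_cap] makes it a letter
    [d]. *)
Let q13_orbit x : pure_orbit x -> exists l m, x = power q13 m (power k l e).
Proof.
suff d_orbit y : pure_orbit y -> exists l m, y = power d m (power k l e).
  case/d_orbit=> l [m ->]; exists (negs m l), m.
  by rewrite -d_power_orbit negsK.
case=> l [m ->]; elim/last_ind: m => [|m c [l' [m' IHm]]]; first by exists l, [::].
rewrite power_rcons IHm -(commuting_power (g := k' c)); last first.
  by move=> a; apply/commutingC/(lr_q_q13 br).
rewrite klein_power; set c' := iter _ _ c.
exists (map negb l'), (~~ c' :: m').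
rewrite power_cons -(commuting_power _ (d_rl (~~ c'))).
by rewrite /d (q_q13_cap br cap) negbK.
Qed.

(** The states of the orbit can be written with [q13] or with [k'] after a power of [k]. The
    crossing [Classical false], which is [V1] after [q false], carries the first form to the second
    with the same l and m; [Classical true] carries it back. *)
Lemma pure_orbit_letter c x : pure_orbit x -> pure_orbit (h1 c x).
Proof.
have q13_letter l m : h1 (Classical false) (power q13 m (power k l e)) =
    power k' m (power k l e).
  have -> x' : h1 (Classical false) x' = V1 (q false x').
    by rewrite /lr (letterK1 br Virtual).
  rewrite -(commuting_power (g := q false)); last first.
    by move=> b; apply/commutingC/(q_q13C br).
  by rewrite q_power_rl q13_power (cap_power_rl br cap) map_negbK.
case: c => [[]|].
- case=> l [m ->]; rewrite -q13_letter (letterK1 br (Classical false)).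
  exact: pure_orbit_q13.
- by case/q13_orbit=> l [m ->]; rewrite q13_letter; exists l, m.
- case/q13_orbit=> l [m ->]; rewrite q13_power (cap_power_rl br cap).
  by exists (map negb l), m.
Qed.

Lemma pure_orbit_base : pure_orbit e.
Proof. by exists [::], [::]. Qed.

(** Two virtual crossings inserted between the letters split the pair into two arrows, or cancelling
    pairs of virtual crossings. *)
Lemma pure_orbit_pair c1 c2 x : pure_orbit x -> pure_orbit (h2 c2 (h2 c1 x)).
Proof.
move=> Ox; have VK2 : involutive (h2 Virtual) := letterK2 br Virtual.
have pure_orbit_lr b y : pure_orbit y -> pure_orbit (k' b y).
  by case=> l [m ->]; exists l, (rcons m b); rewrite power_rcons.
have : pure_orbit (h2 Virtual (h2 c1 x)).
  case: c1 => [[]|]; [exact: (pure_orbit_rl true) | exact: (pure_orbit_lr false) | by rewrite VK2].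
rewrite -{2}(VK2 (h2 c1 x)); move: (h2 Virtual _) => y Oy.
by case: c2 => [[]|]; [exact: (pure_orbit_lr true) | exact: (pure_orbit_rl false) | rewrite VK2].
Qed.

(** Conjugation by [V2] makes arrows between the legs 1 and 2 into arrows between 1 and 3. This will
    compare a braid seen from one cap with a braid seen from the other. *)
Lemma pure_orbit_across l m :
  pure_orbit (h2 Virtual (power q m (power (rl h1) l (h2 Virtual e)))).
Proof.
have VK1 : involutive V1 := letterK1 br Virtual.
have VK2 : involutive (h2 Virtual) := letterK2 br Virtual.
have q13_conj x : h2 Virtual (power q m x) = power q13 m (h2 Virtual x).
  elim/last_ind: m => // {}m b IHm.
  by rewrite !power_rcons -IHm /PureBraids.q13 VK2.
have rl_conj b x : h2 Virtual (rl h1 b (h2 Virtual x)) = V1 (k b (V1 x)).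
  case: b; rewrite /rl.
    rewrite -[h2 _ (V1 x)]VK1 (detour br (Classical true)).
    by rewrite (mixed12 br Virtual) VK2.
  by rewrite -[h2 _ (V1 x)]VK1 (detour br) (mixed12 br Virtual) VK2.
rewrite q13_conj.
have -> : h2 Virtual (power (rl h1) l (h2 Virtual e)) = V1 (power k l (V1 e)).
  elim/last_ind: l => [|l b IHl]; first by rewrite /= VK1 VK2.
  by rewrite !power_rcons -[power _ _ (h2 _ _)]VK2 rl_conj IHl VK1.
rewrite (capE cap) (cap_power_rl br cap); exact: pure_orbit_q13.
Qed.

End Orbit.

(** * Four legs, two caps and the wink-moves *)

Lemma mirrorK h : mirror (mirror h) = h.
Proof. by apply: functional_extensionality => c; rewrite /mirror flipK. Qed.

(* The four legs of a bent tangle; in e they are joined by two caps. *)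
Record square (g1 g2 g3 : crossing -> X -> X) (e : X) : Prop := Square {
  braided12 : braided g1 g2;
  braided32 : braided (mirror g3) (mirror g2);
  far13 : forall c d x, g1 c (g3 d x) = g3 d (g1 c x);
  capped1 : capped g1 g2 e;
  capped3 : capped (mirror g3) (mirror g2) e;
  winkL : forall b c, g1 (Classical c) (rl g2 b e) = rl g2 b e;
  winkR : forall b c, g3 (Classical c) (lr g2 b e) = lr g2 b e }.

Lemma square_mirror g1 g2 g3 e :
  square g1 g2 g3 e -> square (mirror g3) (mirror g2) (mirror g1) e.
Proof.
case=> br12 br32 far cap1 cap3 wL wR; split; rewrite ?mirrorK //.
- by move=> c d x; rewrite /mirror far.
- by move=> b c; rewrite rl_mirror; apply: wR.
- by move=> b c; rewrite lr_mirror; apply: wL.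
Qed.

Section Square.
Variables (g1 g2 g3 : crossing -> X -> X) (e : X).
Hypothesis sq : square g1 g2 g3 e.

Local Notation k := (rl g2).
Local Notation k' := (lr g2).
Local Notation q := (lr g1).
Local Notation q13 := (q13 g1 g2).
Local Notation V1 := (g1 Virtual).
Local Notation V2 := (g2 Virtual).
Local Notation V3 := (g3 Virtual).

Let br12 := braided12 sq.
Let br32 := braided32 sq.
Let cap1 := capped1 sq.
Let cap3 := capped3 sq.
Let VK1 : involutive V1 := letterK1 br12 Virtual.
Let capV3 : V3 e = e := capE cap3 Virtual.
Let lr2K := lrK (letterK2 br12).

Let cap3_lr b : V3 (k' b e) = k' (~~ b) e.
Proof.
by have := cap_rl br32 cap3 (~~ b); rewrite !rl_mirror negbK.
Qed.

Let lr_lr24 a b : commuting (fun x => V3 (k' a (V3 x))) (k' b).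
Proof.
by move=> x; have := rl_rl13 br32 (~~ a) (~~ b) x; rewrite !rl_mirror !negbK.
Qed.

Let letter23 c x : g2 c (V3 (V2 x)) = V3 (V2 (g3 c x)).
Proof. by have := mixed21 br32 (flip c) x; rewrite /mirror flipK => ->. Qed.

Let letter32 c x : V2 (V3 (g2 c x)) = g3 c (V2 (V3 x)).
Proof. by have := mixed12 br32 (flip c) x; rewrite /mirror flipK => ->. Qed.

(* The arrows from 1 to 4 and from 2 to 3 have no common strand. *)
Let q14_lr a b : commuting (fun x => V3 (q13 a (V3 x))) (k' b).
Proof.
move=> x; rewrite /q13.
have -> y : V2 (V3 (k' b y)) = lr g3 b (V2 (V3 y)).
  by case: b; rewrite /lr !letter32.
have far_q b' y : q a (lr g3 b' y) = lr g3 b' (q a y).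
  by case: a b' => -[]; rewrite /lr !(far13 sq).
by rewrite far_q; case: b; rewrite /lr !letter23.
Qed.

(** The argument of [cap_power_rl] fails, as here conjugation by [V1] changes the overstrand. So the
    second cap first moves the head of the last arrow from leg 3 to leg 4; conjugated by [V1] it
    runs from 1 to 4, commutes with [k'], and is absorbed at [e]. *)
Lemma cap_power_lr m : V1 (power k' m e) = power k' (map negb m) e.
Proof.
elim/last_ind: m => [|m b IHm]; first exact: capE cap1 _.
rewrite map_rcons !power_rcons.
have -> : k' b (power k' m e) = V3 (k' (~~ b) (V3 (power k' m e))).
  rewrite -(commuting_power (g := fun x => V3 (k' (~~ b) (V3 x)))); last first.
    by move=> a; apply/commutingC/lr_lr24.
  rewrite capV3 cap3_lr negbK -(power_rconsC _ _ _ lr2K).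
  by rewrite power_cons.
rewrite (far13 sq) -[power k' m e]VK1 IHm -[V3 (V1 (power _ _ _))](far13 sq).
rewrite -q13E //.
rewrite -(commuting_power (g := fun x => V3 (q13 (~~ b) (V3 x)))); last first.
  by move=> a; apply/commutingC/q14_lr.
rewrite capV3 (q13_cap br12 cap1) negbK cap3_lr.
by rewrite -(power_rconsC _ _ _ lr2K).
Qed.

End Square.

Section Klein.
Variables (g1 g2 g3 : crossing -> X -> X) (e : X).
Hypothesis sq : square g1 g2 g3 e.

Local Notation k := (rl g2).
Local Notation k' := (lr g2).
Local Notation q := (lr g1).
Local Notation q13 := (q13 g1 g2).
Local Notation p := (rl g3).
Local Notation V1 := (g1 Virtual).
Local Notation V2 := (g2 Virtual).
Local Notation V3 := (g3 Virtual).

Let br12 := braided12 sq.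
Let br32 := braided32 sq.
Let cap1 := capped1 sq.
Let cap3 := capped3 sq.
Let VK2 : involutive V2 := letterK2 br12 Virtual.

Let p13 b x := V2 (p b (V2 x)).

Let pE b : lr (mirror g3) b = p (~~ b).
Proof. by apply: functional_extensionality => x; rewrite lr_mirror. Qed.

Let p13E b x : p13 b x = V3 (k b (V3 x)).
Proof.
have := q13E br32 (~~ b) x.
by rewrite /PureBraids.q13 pE lr_mirror !negbK.
Qed.

Let p_p13C a b : commuting (p a) (p13 b).
Proof.
have := q_q13C br32 (~~ a) (~~ b).
by rewrite /PureBraids.q13 !pE !negbK.
Qed.

Let p13_power x l : V3 (power p13 l x) = power k l (V3 x).
Proof.
elim/last_ind: l => // l b IHl; rewrite !power_rcons p13E -IHl.
exact: (letterK1 br32 Virtual).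
Qed.

Let p13_power_cap l : power p13 l e = power k (map negb l) e.
Proof.
have lrE m : power (lr (mirror g2)) m e = power k (map negb m) e.
  by rewrite power_neg; apply: eq_power => b y; apply: lr_mirror.
have := cap_power_lr (square_mirror sq) (map negb l).
rewrite !lrE !map_negbK => <-; rewrite -{2}(capE cap3 Virtual).
by rewrite -p13_power (letterK1 br32 Virtual).
Qed.

(** By [winkR] the classical crossing in [p] does nothing here; the virtual one inverts [k']. *)
Let p_power_lr l c : power p l (k' c e) = k' (iter (size l) negb c) e.
Proof.
have wink b a : p b (k' a e) = k' (~~ a) e.
  have V3E a' : V3 (k' a' e) = k' (~~ a') e.
    by have := cap_rl br32 cap3 (~~ a'); rewrite !rl_mirror negbK.
  by case: b; rewrite /rl ?(winkR sq) V3E // (winkR sq).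
by elim: l c => //= b l IHl c; rewrite wink IHl -iterS iterSr.
Qed.

Let p_p13_power l x : power (fun b y => p b (p13 b y)) l x = power p13 l (power p l x).
Proof.
elim/last_ind: l => // l b IHl; rewrite !power_rcons IHl p_p13C.
by rewrite -(commuting_power (g := p b)) // => a; apply: commutingC.
Qed.

(* Both sides are e with arrows from the leg 1 to 3 and from 4 to 2, which
   commute. *)
Let hub l c : power p13 l (k' c e) = q13 (~~ c) (power k (map negb l) e).
Proof.
rewrite -{1}[c]negbK -(q13_cap br12 cap1) -p13_power_cap.
rewrite (commuting_power (g := q13 (~~ c))) // => b x.
rewrite /p13 /PureBraids.q13 !VK2.
by case: b; case: c; rewrite /rl /lr /= !(far13 sq).
Qed.

(** The reading from the right. [p] and [p13] together carry leg 4 over the legs 3 and 2, hence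
    commute with [k']. The factor [p] is trivial on [e], but on [k' c e] it inverts [k']. *)
Let lr_after_rl c l : k' c (power k (map negb l) e) =
  q13 (~~ iter (size l) negb c) (power k (map negb l) e).
Proof.
rewrite -hub -p_power_lr -p_p13_power.
have cd b : commuting (fun y => p b (p13 b y)) (k' c).
  have := rl_q_q13 br32 (~~ c) (~~ b).
  move=> com x; have := com x.
  by rewrite /= !rl_mirror /PureBraids.q13 !pE !negbK.
rewrite (commuting_power _ cd) p_p13_power -p13_power_cap.
have -> // : power p l e = e.
elim: l => //= b l IHl; rewrite -[RHS]IHl; congr power.
by have := q_cap cap3 (~~ b); rewrite pE negbK.
Qed.

(** The reading from the left: by [q_q13_cap], [k' c e] is [e] with leg 1 passed over the legs 2 and
    3, and such a passage commutes with [k]. *)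
Let rl_after_lr c l : power k l (k' c e) =
  q (~~ c) (q13 (~~ c) (power k l e)).
Proof.
rewrite -{1}[c]negbK -(q_q13_cap br12 cap1).
by rewrite (commuting_power (g := q (~~ c) \o q13 (~~ c))) // => b; apply: rl_q_q13.
Qed.

(** The two readings differ by one letter [q]; by [winkL] this letter inverts [k b e]. *)
Lemma klein_cap b c : k b (k' c e) = k' (~~ c) (k (~~ b) e).
Proof.
have := lr_after_rl (~~ c) [:: b]; rewrite /= negbK => ->.
have := rl_after_lr c [:: b]; rewrite /= q_q13C // => ->; congr q13.
have V1E a : V1 (k a e) = k (~~ a) e by apply: cap_rl.
by case: (c); rewrite /lr ?V1E ?(winkL sq) ?V1E.
Qed.

(** The wink-move concerns a single [k]. For longer powers the two readings are compared again, with
    [klein] now carrying [k'] through the whole power; the sign changes, twice the length of l,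
    cancel. *)
Lemma q_power_rl b l :
  (forall b c x, k b (k' c x) = k' (~~ c) (k (~~ b) x)) ->
  q b (power k l e) = power k (map negb l) e.
Proof.
move=> klein; apply: (can_inj (q13K br12 b)); rewrite -q_q13C //.
have := rl_after_lr (~~ b) l; rewrite negbK => <-.
have -> m c : power k m (k' c e) = k' (iter (size m) negb c) (power k (map negb m) e).
  elim/last_ind: m c => // m a IHm c.
  by rewrite map_rcons !power_rcons IHm klein size_rcons.
rewrite lr_after_rl -iterD addnn.
have -> : iter (size l).*2 negb (~~ b) = ~~ b.
  by elim: (size l) => // n IHn; rewrite doubleS !iterS IHn !negbK.
by rewrite negbK.
Qed.

End Klein.
End PureBraids.

Lemma power_conj X (h : crossing -> X -> X) m x : involutive (h Virtual) ->
  h Virtual (power (lr h) m x) = power (rl h) m (h Virtual x) /\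
  h Virtual (power (rl h) m x) = power (lr h) m (h Virtual x).
Proof.
move=> VK; elim/last_ind: m => // m b [IHlr IHrl]; rewrite !power_rcons -IHlr -IHrl.
by case: b; rewrite /lr /rl !VK.
Qed.

Section Morphism.
Variables (X Y : Type) (phi : X -> Y).
Variables (h : crossing -> X -> X) (h' : crossing -> Y -> Y).
Hypothesis phiM : forall c x, phi (h c x) = h' c (phi x).

Lemma rl_morph b x : phi (rl h b x) = rl h' b (phi x).
Proof. by case: b; rewrite /rl !phiM. Qed.

Lemma lr_morph b x : phi (lr h b x) = lr h' b (phi x).
Proof. by case: b; rewrite /lr !phiM. Qed.

End Morphism.

Lemma power_morph (X Y : Type) (phi : X -> Y) F G l x :
  (forall b y, phi (F b y) = G b (phi y)) -> phi (power F l x) = power G l (phi x).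
Proof. by move=> phiM; elim: l x => //= b l IHl x; rewrite IHl phiM. Qed.

(** * Planar isotopy of words of slices *)

(** Bare words spare the width proofs. Moves preserve widths, so a chain of words that starts at a
    diagram consists of diagrams ([eqv_wink_equivalent]). *)
Definition step (n : nat) (u v : seq slice) : Prop :=
  (local isotopy n u v \/ local welded_move n u v) \/ local wink_move n u v.

Definition eqv (n : nat) : seq slice -> seq slice -> Prop :=
  clos_refl_sym_trans (seq slice) (step n).

Lemma eqv_refl n u : eqv n u u.
Proof. exact: rst_refl. Qed.

Lemma eqv_sym n u v : eqv n u v -> eqv n v u.
Proof. exact: rst_sym. Qed.

Lemma eqv_trans n v u w : eqv n u v -> eqv n v w -> eqv n u w.
Proof. exact: rst_trans. Qed.

Hint Resolve eqv_refl : core.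

Lemma shift0 w : shift 0 w = w.
Proof. by elim: w => [|[i g] w /= ->]. Qed.

Lemma shift_cat i u v : shift i (u ++ v) = shift i u ++ shift i v.
Proof. exact: map_cat. Qed.

Lemma shift_shift i j w : shift i (shift j w) = shift (i + j) w.
Proof. by rewrite /shift -map_comp; apply: eq_map => x /=; rewrite addnA. Qed.

Lemma width_at i p N m w : i + p <= N -> width p w = Some m ->
  width N (shift i w) = Some (i + m + (N - (i + p))).
Proof. by move=> le /(width_shift i (N - (i + p))); rewrite subnKC. Qed.

Lemma isotopy_width p a b :
  isotopy p a b -> exists m, width p a = Some m /\ width p b = Some m.
Proof.
case=> [g h k|||[]|[]]; try by eexists; split.
exists (nbot g + k + nbot h) => /=.
by split; repeat case: ifP => ?; first [congr Some; lia | lia].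
Qed.

Lemma welded_width p a b :
  welded_move p a b -> exists m, width p a = Some m /\ width p b = Some m.
Proof. by case=> [c|c|c1 c2 c3 _]; eexists; split. Qed.

Lemma wink_width p a b :
  wink_move p a b -> exists m, width p a = Some m /\ width p b = Some m.
Proof. by case=> c K []; eexists; split. Qed.

Lemma local_width M n a b :
  (forall p a b, M p a b -> exists m, width p a = Some m /\ width p b = Some m) ->
  local M n a b -> width n a = width n b.
Proof.
move=> Mw [u v a' b' i p N /Mw[m [wa wb]] wu le].
by rewrite !width_cat wu /= !width_cat (width_at le wa) (width_at le wb).
Qed.

Lemma step_width n a b : step n a b -> width n a = width n b.
Proof.
case=> [[]|]; apply: local_width.
- exact: isotopy_width.
- exact: welded_width.
- exact: wink_width.
Qed.

Lemma eqv_width n a b : eqv n a b -> width n a = width n b.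
Proof. by elim=> // [{}a {}b /step_width|{}a c {}b _ -> _ ->]. Qed.

Lemma local_context M n u v i p N a b :
  width n u = Some N -> i + p <= N ->
  local M p a b -> local M n (u ++ shift i a ++ v) (u ++ shift i b ++ v).
Proof.
move=> wu le [u' v' a' b' j p' N' Mab wu' le'].
rewrite !shift_cat !shift_shift -!catA !(catA u).
apply: (Local _ Mab (N := i + N' + (N - (i + p)))); last by lia.
by rewrite width_cat wu /= (width_at le wu').
Qed.

Lemma eqv_context n u v i p N a b :
  width n u = Some N -> i + p <= N ->
  eqv p a b -> eqv n (u ++ shift i a ++ v) (u ++ shift i b ++ v).
Proof.
move=> wu le; elim=> [{}a {}b st|{}a|{}a {}b _ IH|{}a c {}b _ IH1 _ IH2].
- apply: rst_step; case: st => [[]|] st; [left; left | left; right | right];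
    exact: (local_context _ wu le st).
- exact: eqv_refl.
- exact: eqv_sym.
- exact: eqv_trans IH1 IH2.
Qed.

Lemma eqv_catl n u N a b : width n u = Some N -> eqv N a b -> eqv n (u ++ a) (u ++ b).
Proof.
move=> wu ab; have := eqv_context [::] (i := 0) wu (leqnn _) ab.
by rewrite !shift0 !cats0.
Qed.

Lemma eqv_catr n v a b : eqv n a b -> eqv n (a ++ v) (b ++ v).
Proof.
move=> ab; have := @eqv_context n [::] v 0 n n a b erefl (leqnn _) ab.
by rewrite !shift0.
Qed.

Lemma eqv_cons n x a b N : width n [:: x] = Some N -> eqv N a b -> eqv n (x :: a) (x :: b).
Proof. exact: (@eqv_catl n [:: x]). Qed.

Lemma eqv_at n i p a b v : i + p <= n -> eqv p a b ->
  eqv n (shift i a ++ v) (shift i b ++ v).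
Proof. exact: (@eqv_context n [::] v i p n). Qed.

Lemma eqv_of_isotopy p a b : isotopy p a b -> eqv p a b.
Proof.
move=> ab; apply: rst_step; left; left.
have := @Local isotopy p [::] [::] a b 0 p p ab erefl (leqnn _).
by rewrite !shift0 !cats0.
Qed.

Lemma eqv_of_welded p a b : welded_move p a b -> eqv p a b.
Proof.
move=> ab; apply: rst_step; left; right.
have := @Local welded_move p [::] [::] a b 0 p p ab erefl (leqnn _).
by rewrite !shift0 !cats0.
Qed.

Lemma eqv_of_wink p a b : wink_move p a b -> eqv p a b.
Proof.
move=> ab; apply: rst_step; right.
have := @Local wink_move p [::] [::] a b 0 p p ab erefl (leqnn _).
by rewrite !shift0 !cats0.
Qed.

Lemma eqv_wink_equivalent n m (D E : diagram n m) :
  eqv n D E -> wink_equivalent D E.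
Proof.
suff gen a b : eqv n a b -> forall (wa : width n a == Some m)
    (wb : width n b == Some m), wink_equivalent (Diagram wa) (Diagram wb).
  by move=> /gen; case: D E => [a wa] [b wb]; apply.
elim=> [{}a {}b st wa wb|{}a wa wb|{}a {}b _ IH wa wb|{}a c {}b ac IH1 cb IH2 wa wb].
- exact: rst_step.
- by rewrite (bool_irrelevance wa wb); apply: rst_refl.
- exact/rst_sym/IH.
- have wc : width n c == Some m by rewrite -(eqv_width ac).
  exact: rst_trans (IH1 wa wc) (IH2 wc wb).
Qed.

Lemma exchange_slice i g u a b c :
  width a u = Some b -> i + ntop g <= c ->
  eqv (a + c) (u ++ [:: (b + i, g)]) ((a + i, g) :: u).
Proof.
elim: u a => [|[j h] u IHu] a /=; first by case=> ->.
case: ifP => // le_j wu le_i.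
have ex : eqv (a + c) [:: (j, h); (a - ntop h + nbot h + i, g)]
    [:: (a + i, g); (j, h)].
  have := eqv_at [::] (i := j) _ (eqv_of_isotopy (IsoExchange h g (a - (j + ntop h) + i))).
  rewrite /= => /(_ (a + c)); set le := _ <= _ => ex.
  have := ex _; rewrite /le {ex le}.
  have -> : j + (nbot h + (a - (j + ntop h) + i)) = a - ntop h + nbot h + i by lia.
  have -> : j + (ntop h + (a - (j + ntop h) + i)) = a + i by lia.
  by rewrite addn0; apply; lia.
apply: eqv_trans (eqv_catr u ex); rewrite cat_cons.
apply: (@eqv_cons _ _ _ _ (a - ntop h + nbot h + c)).
  by rewrite /= ifT; [congr Some; lia | lia].
exact: IHu.
Qed.

Lemma exchange u v a b c d :
  width a u = Some b -> width c v = Some d ->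
  eqv (a + c) (u ++ shift b v) (shift a v ++ u).
Proof.
elim: v c => [|[i g] v IHv] c wu /=; first by rewrite cats0.
case: ifP => // le_i wv.
rewrite -cat_rcons -cats1.
apply: eqv_trans (eqv_catr _ (exchange_slice wu le_i)) _.
rewrite cat_cons; apply: (@eqv_cons _ _ _ _ (a + (c - ntop g + nbot g))).
  by rewrite /= ifT; [congr Some; lia | lia].
exact: IHv.
Qed.

Lemma shift_cons i j g w : shift i ((j, g) :: w) = (i + j, g) :: shift i w.
Proof. by []. Qed.

Lemma shift_nil i : shift i [::] = [::].
Proof. by []. Qed.

Arguments shift : simpl never.

Lemma eqv_rewrite u i p a b v n L R :
  eqv p a b -> L = u ++ shift i a ++ v -> R = u ++ shift i b ++ v ->
  (if width n u is Some N then i + p <= N else false) -> eqv n L R.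
Proof.
move=> ab -> ->; case wu: (width n u) => [N|//] le.
exact: eqv_context wu le ab.
Qed.

Lemma width_block S i N w :
  width 2 S = Some 2 -> i + 2 <= N -> width N (shift i S ++ w) = width N w.
Proof.
by move=> wS le; rewrite width_cat (width_at le wS) /= subnKC.
Qed.

Lemma width_block0 S i N :
  width 2 S = Some 2 -> i + 2 <= N -> width N (shift i S) = Some N.
Proof. by move=> wS le; rewrite -[shift i S]cats0 width_block. Qed.

Lemma width_pad S k : width 2 S = Some 2 -> width (2 + k) S = Some (2 + k).
Proof. by move=> wS; rewrite -[S]shift0 width_block0. Qed.

(* Clockwise rotation by a quarter turn. *)
Definition turn (S : seq slice) : seq slice :=
  (2, Cap) :: shift 1 S ++ [:: (0, Cup)].

Ltac flatten_word :=
  rewrite /hstack_slices /turn /= -?catA /=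
    ?(shift_cat, shift_cons, shift_nil, shift_shift, shift0) -?catA /= ?cats0 -?catA /=.

Lemma width_head S N w :
  width 2 S = Some 2 -> 2 <= N -> width N (S ++ w) = width N w.
Proof. by move=> wS le; rewrite -{1}[S]shift0 width_block. Qed.

Lemma width_head0 S N : width 2 S = Some 2 -> 2 <= N -> width N S = Some N.
Proof. by move=> wS le; rewrite -[S]cats0 width_head. Qed.

Ltac width_simpl :=
  repeat first
    [ match goal with
      | H : width ?n ?S = Some _ |- context [width ?n ?S] => rewrite H
      | H : width 2 ?S = Some 2 |- context [width _ (?S ++ _)] =>
          rewrite (width_head _ H) //
      | H : width 2 ?S = Some 2 |- context [width _ ?S] =>
          rewrite (width_head0 H) //
      end
    | progress rewrite /= ?width_block ?width_block0 // ].

(* [rewrite_word u i v E], where [E : eqv p a b], replaces the left-hand side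
   [u ++ shift i a ++ v] of the goal by [u ++ shift i b ++ v]. *)
Tactic Notation "rewrite_word" constr(u) constr(i) constr(v) constr(E) :=
  eapply eqv_trans;
  [ eapply (@eqv_rewrite u i _ _ _ v _ _ _ E);
    [ flatten_word; reflexivity
    | reflexivity
    | width_simpl ]
  | flatten_word ].

Lemma zigzag : eqv 1 [:: (0, Cap); (1, Cup)] [::].
Proof. exact/eqv_of_isotopy/IsoZigzag. Qed.
Lemma zagzig : eqv 1 [:: (1, Cap); (0, Cup)] [::].
Proof. exact/eqv_of_isotopy/IsoZagzig. Qed.
Lemma cap_cross c : eqv 1 [:: (0, Cap); (1, Cross c)] [:: (1, Cap); (0, Cross (flip c))].
Proof. exact/eqv_of_isotopy/IsoCap. Qed.
Lemma cross_cup c : eqv 3 [:: (0, Cross c); (1, Cup)] [:: (1, Cross (flip c)); (0, Cup)].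
Proof. exact/eqv_of_isotopy/IsoCup. Qed.
Lemma cross_cross c : eqv 2 [:: (0, Cross c); (0, Cross (flip c))] [::].
Proof. exact/eqv_of_welded/WeldedII. Qed.

Lemma exchange_pieces g h k : eqv (ntop g + k + ntop h)
  [:: (0, g); (nbot g + k, h)] [:: (ntop g + k, h); (0, g)].
Proof. exact/eqv_of_isotopy/IsoExchange. Qed.

(** A kink is created on the right foot of the cap. Moving its crossing through its minimum leaves
    the crossing directly below a cap, and the rest straightens. *)
Lemma cap_kink c : eqv 0 [:: (0, Cap); (0, Cross c)] [:: (0, Cap)].
Proof.
apply: eqv_sym; have kink := eqv_sym (eqv_of_welded (WeldedI (flip c))).
rewrite_word [:: (0, Cap)] 1 (Nil slice) kink.
rewrite_word [:: (0, Cap); (2, Cap)] 1 (Nil slice) (cross_cup (flip c)).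
rewrite flipK.
have ex := @exchange [:: (0, Cap)] [:: (0, Cap); (0, Cross c)] 0 2 0 2 erefl erefl.
rewrite_word (Nil slice) 0 [:: (1, Cup)] ex.
by rewrite_word [:: (0, Cap); (0, Cross c)] 0 (Nil slice) zigzag.
Qed.

Lemma turn_width S : width 2 S = Some 2 -> width 2 (turn S) = Some 2.
Proof. by move=> wS; rewrite /= width_block. Qed.

(** * Stackings and quarter turns *)

Section Blocks.
Variables A B C : seq slice.
Hypotheses (wA : width 2 A = Some 2) (wB : width 2 B = Some 2)
  (wC : width 2 C = Some 2).

Local Notation cup := [:: (0, Cup)].
Local Notation cap := [:: (0, Cap)].

(** A clockwise turn brings the upper block to the right. After exchanges of heights, the arcs
    gluing the two turned blocks straighten as two zigzags. *)
Lemma turn_cat : eqv 2 (turn (A ++ B)) (hstack_slices (turn B) (turn A)).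
Proof.
apply: eqv_sym.
have ex1 := exchange (turn_width wB) (turn_width wA).
rewrite_word [:: (1, Cap)] 0 [:: (1, Cup)] ex1.
have ex2 := @exchange cup [:: (1, Cup)] 2 0 3 1 erefl erefl.
rewrite_word ([:: (1, Cap); (4, Cap)] ++ shift 3 A ++ [:: (2, Cup); (2, Cap)] ++ shift 1 B)
  0 (Nil slice) ex2.
have ex3 := @exchange B cup 2 2 2 0 wB erefl.
rewrite_word ([:: (1, Cap); (4, Cap)] ++ shift 3 A ++ [:: (2, Cup); (2, Cap)])
  1 cup ex3.
rewrite_word ([:: (1, Cap); (4, Cap)] ++ shift 3 A ++ [:: (2, Cup)])
  2 (shift 1 B ++ cup) zigzag.
have ex4 := @exchange [:: (1, Cap)] ((1, Cap) :: A) 1 3 1 3 erefl (width_pad 1 wA).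
rewrite_word (Nil slice) 0 ([:: (2, Cup)] ++ shift 1 B ++ cup) ex4.
rewrite_word ((2, Cap) :: shift 1 A) 1 (shift 1 B ++ cup) zigzag.
by [].
Qed.

Lemma turn_hstack : eqv 2 (turn (hstack_slices A B)) (turn A ++ turn B).
Proof.
apply: eqv_sym.
have ex1 := @exchange cup [:: (2, Cap)] 2 0 2 4 erefl erefl.
rewrite_word ((2, Cap) :: shift 1 A) 0 (shift 1 B ++ cup) ex1.
have wB1 : width 4 (shift 1 B) = Some 4 by rewrite width_block0.
have ex2 := @exchange cup (shift 1 B) 2 0 4 4 erefl wB1.
rewrite_word ((2, Cap) :: shift 1 A ++ [:: (4, Cap)]) 0 cup ex2.
have ex3 := @exchange cup cup 2 0 2 0 erefl erefl.
rewrite_word ((2, Cap) :: shift 1 A ++ (4, Cap) :: shift 3 B) 0 (Nil slice) ex3.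
have ex4 := @exchange A [:: (1, Cap)] 2 2 1 3 wA erefl.
rewrite_word [:: (2, Cap)] 1 (shift 3 B ++ [:: (2, Cup); (0, Cup)]) ex4.
have ex5 := @exchange cap cap 0 2 0 2 erefl erefl.
rewrite_word (Nil slice) 2 (shift 1 A ++ shift 3 B ++ [:: (2, Cup); (0, Cup)]) ex5.
by [].
Qed.

Lemma hstackA :
  eqv 2 (hstack_slices A (hstack_slices B C)) (hstack_slices (hstack_slices A B) C).
Proof.
apply: eqv_sym.
have ex1 := @exchange [:: (1, Cup)] C 4 2 2 2 erefl wC.
rewrite_word ([:: (1, Cap); (1, Cap)] ++ A ++ shift 2 B) 0 [:: (1, Cup)] ex1.
have ex2 := @exchange cup cup 2 0 2 0 erefl erefl.
rewrite_word ([:: (1, Cap); (1, Cap)] ++ A ++ shift 2 B ++ shift 4 C) 1 (Nil slice) ex2.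
have ex3 := @exchange cap cap 0 2 0 2 erefl erefl.
rewrite_word (Nil slice) 1 (A ++ shift 2 B ++ shift 4 C ++ [:: (3, Cup); (1, Cup)])
  (eqv_sym ex3).
have ex4 := @exchange A [:: (1, Cap)] 2 2 2 4 wA erefl.
rewrite_word [:: (1, Cap)] 0 (shift 2 B ++ shift 4 C ++ [:: (3, Cup); (1, Cup)])
  (eqv_sym ex4).
by [].
Qed.

Lemma hstack0l : eqv 2 (hstack_slices (turn [::]) A) A.
Proof.
have ex1 := @exchange cup cap 2 0 0 2 erefl erefl.
rewrite_word [:: (1, Cap)] 0 (shift 2 A ++ [:: (1, Cup)]) (eqv_sym ex1).
rewrite_word (Nil slice) 0 (cap ++ shift 2 A ++ [:: (1, Cup)]) zagzig.
have ex2 := @exchange cap A 0 2 2 2 erefl wA.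
rewrite_word (Nil slice) 0 [:: (1, Cup)] ex2.
by rewrite_word A 0 (Nil slice) zigzag.
Qed.

Lemma hstack0r : eqv 2 (hstack_slices A (turn [::])) A.
Proof.
have ex1 := @exchange cup cap 2 0 0 2 erefl erefl.
rewrite_word ((1, Cap) :: A) 2 [:: (1, Cup)] (eqv_sym ex1).
have ex2 := @exchange A cup 2 2 2 0 wA erefl.
rewrite_word [:: (1, Cap)] 0 [:: (2, Cap); (1, Cup)] ex2.
rewrite_word (Nil slice) 1 (A ++ [:: (2, Cap); (1, Cup)]) zigzag.
by rewrite_word A 1 (Nil slice) zagzig.
Qed.

Lemma hstack_eqv A' B' : eqv 2 A A' -> eqv 2 B B' ->
  eqv 2 (hstack_slices A B) (hstack_slices A' B').
Proof.
move=> AA' BB'.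
rewrite_word [:: (1, Cap)] 0 (shift 2 B ++ [:: (1, Cup)]) AA'.
have wA' : width 2 A' = Some 2 by rewrite -(eqv_width AA').
by rewrite_word ((1, Cap) :: A') 2 [:: (1, Cup)] BB'.
Qed.

Lemma turn_eqv A' : eqv 2 A A' -> eqv 2 (turn A) (turn A').
Proof. by move=> AA'; rewrite_word [:: (2, Cap)] 1 cup AA'. Qed.

Lemma hstack_width : width 2 (hstack_slices A B) = Some 2.
Proof. by rewrite /hstack_slices; width_simpl. Qed.

End Blocks.

Lemma turn_cross c : eqv 2 (turn [:: (0, Cross c)]) [:: (0, Cross (flip c))].
Proof.
have cc := eqv_sym (cap_cross (flip c)); rewrite flipK in cc.
rewrite_word (Nil slice) 1 [:: (0, Cup)] cc.
have ex := @exchange [:: (0, Cup)] [:: (0, Cross (flip c))] 2 0 2 2 erefl erefl.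
rewrite_word [:: (1, Cap)] 0 (Nil slice) (eqv_sym ex).
by rewrite_word (Nil slice) 0 [:: (0, Cross (flip c))] zagzig.
Qed.

Definition braid (cs : seq crossing) : seq slice := [seq (0, Cross c) | c <- cs].

Lemma braid_width cs : width 2 (braid cs) = Some 2.
Proof. by elim: cs. Qed.

Lemma turn_turn_nil : eqv 2 (turn (turn [::])) [::].
Proof.
have ex := @exchange [:: (0, Cup)] [:: (0, Cap)] 2 0 0 2 erefl erefl.
rewrite_word [:: (2, Cap)] 1 [:: (0, Cup)] (eqv_sym ex).
rewrite_word (Nil slice) 1 [:: (1, Cap); (0, Cup)] zagzig.
by rewrite_word (Nil slice) 0 (Nil slice) zagzig.
Qed.

Lemma turn_turn_cat A B : width 2 A = Some 2 -> width 2 B = Some 2 ->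
  eqv 2 (turn (turn (A ++ B))) (turn (turn B) ++ turn (turn A)).
Proof.
move=> wA wB; apply: eqv_trans (turn_eqv (turn_cat wA wB)) _.
exact: turn_hstack (turn_width wB) (turn_width wA).
Qed.

Lemma cat_eqv A A' B B' : width 2 A = Some 2 -> eqv 2 A A' -> eqv 2 B B' ->
  eqv 2 (A ++ B) (A' ++ B').
Proof.
move=> wA AA' BB'; apply: eqv_trans (eqv_catl wA BB') _.
exact: eqv_catr.
Qed.

Lemma turn_turn_braid cs : eqv 2 (turn (turn (braid cs))) (braid (rev cs)).
Proof.
elim: cs => [|c cs IHcs]; first exact: turn_turn_nil.
apply: eqv_trans (@turn_turn_cat [:: (0, Cross c)] _ erefl (braid_width cs)) _.
rewrite rev_cons -cats1 /braid map_cat.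
apply: cat_eqv IHcs _; first exact/turn_width/turn_width/braid_width.
apply: eqv_trans (turn_eqv (turn_cross c)) _.
by have := turn_cross (flip c); rewrite flipK.
Qed.

Lemma unbend_left T : width 2 T = Some 2 ->
  eqv 2 ((1, Cap) :: shift 2 T ++ [:: (0, Cup)]) T.
Proof.
move=> wT; have ex := @exchange [:: (0, Cup)] T 2 0 2 2 erefl wT.
rewrite_word [:: (1, Cap)] 0 (Nil slice) (eqv_sym ex).
by rewrite_word (Nil slice) 0 T zagzig.
Qed.

Lemma unbend_right T : width 2 T = Some 2 ->
  eqv 2 ((1, Cap) :: T ++ [:: (2, Cup)]) T.
Proof.
move=> wT; have ex := @exchange T [:: (0, Cup)] 2 2 2 0 wT erefl.
rewrite_word [:: (1, Cap)] 0 (Nil slice) ex.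
by rewrite_word (Nil slice) 1 T zigzag.
Qed.

Definition bend (T : seq slice) : seq slice := [:: (0, Cap), (2, Cap) & shift 1 T].

Lemma unbend T : width 2 T = Some 2 ->
  eqv 2 (shift 1 (bend T) ++ [:: (0, Cup); (2, Cup)]) T.
Proof.
move=> wT; rewrite /bend.
have ex := @exchange [:: (0, Cup)] ((1, Cap) :: T) 2 0 1 3 erefl (width_pad 1 wT).
rewrite_word [:: (1, Cap)] 0 [:: (2, Cup)] (eqv_sym ex).
rewrite_word (Nil slice) 0 ([:: (1, Cap)] ++ T ++ [:: (2, Cup)]) zagzig.
exact: unbend_right.
Qed.

Lemma unbend_eqv S T : width 2 S = Some 2 -> width 2 T = Some 2 ->
  eqv 0 (bend S) (bend T) -> eqv 2 S T.
Proof.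
move=> wS wT ST; apply: eqv_trans (eqv_sym (unbend wS)) _.
apply: eqv_trans _ (unbend wT).
exact: (@eqv_context 2 [::] _ 1 0 2 _ _ erefl isT ST).
Qed.

Lemma bend_eqv S T : eqv 2 S T -> eqv 0 (bend S) (bend T).
Proof. by move=> ST; rewrite_word [:: (0, Cap); (2, Cap)] 1 (Nil slice) ST. Qed.

(** With the top left corner bent down, a crossing stacked to the left is a crossing of the legs TL
    and BL. Passing through the cup turns it by a quarter, whence [flip]. *)
Lemma hstack_cross_left c T : width 2 T = Some 2 ->
  eqv 2 ((1, Cap) :: shift 2 T ++ [:: (1, Cross (flip c)); (0, Cup)])
        (hstack_slices [:: (0, Cross c)] T).
Proof.
move=> wT.
rewrite_word ((1, Cap) :: shift 2 T) 0 (Nil slice) (eqv_sym (cross_cup c)).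
have ex := @exchange [:: (0, Cross c)] T 2 2 2 2 erefl wT.
by rewrite_word [:: (1, Cap)] 0 [:: (1, Cup)] (eqv_sym ex).
Qed.

Lemma hstack_cross_right c T : width 2 T = Some 2 ->
  eqv 2 ((1, Cap) :: T ++ [:: (1, Cross (flip c)); (2, Cup)])
        (hstack_slices T [:: (0, Cross c)]).
Proof.
move=> wT; have cc := cross_cup (flip c); rewrite flipK in cc.
by rewrite_word ((1, Cap) :: T) 1 (Nil slice) cc.
Qed.

(** * Diagrams up to wink-equivalence *)

(* Equivalence classes are predicates, so that relations between words become
   equalities of states. *)
Section State.
Variables n m : nat.

Record state := State {
  rep :> seq slice -> Prop;
  rep_class : exists2 w, width n w = Some m & rep = eqv n w }.

Lemma rep_width (x : state) w : rep x w -> width n w = Some m.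
Proof. by case: x => P [u wu defP] /=; rewrite defP => /eqv_width <-. Qed.

Lemma rep_eqv (x : state) w w' : rep x w -> eqv n w w' -> rep x w'.
Proof. by case: x => P [u wu defP] /=; rewrite defP; apply: eqv_trans. Qed.

Lemma rep_inj (x : state) w w' : rep x w -> rep x w' -> eqv n w w'.
Proof. by case: x => P [u wu defP] /=; rewrite defP => /eqv_sym; apply: eqv_trans. Qed.

Lemma rep_ex (x : state) : exists w, rep x w.
Proof. by case: x => P [u wu defP]; exists u; rewrite /= defP. Qed.

Lemma state_eq (x y : state) w : rep x w -> rep y w -> x = y.
Proof.
case: x y => P Pc [Q Qc] /= Pw Qw.
have PQ : P = Q.
  have classE R : (exists2 w0, width n w0 = Some m & R = eqv n w0) -> R w -> R = eqv n w.
    move=> [u _ ->] uw; apply: functional_extensionality => v.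
    apply: propositional_extensionality; split; first exact/eqv_trans/eqv_sym.
    exact: eqv_trans.
  by rewrite (classE P) // (classE Q).
by subst Q; congr State; apply: proof_irrelevance.
Qed.

Definition class w (ww : width n w = Some m) : state :=
  State (ex_intro2 _ _ w ww erefl).

Lemma rep_classP w (ww : width n w = Some m) : rep (class ww) w.
Proof. exact: eqv_refl. Qed.

End State.

Section StateMap.
Variables (n m n' m' : nat) (F : seq slice -> seq slice).
Hypothesis F_width : forall w, width n w = Some m -> width n' (F w) = Some m'.
Hypothesis F_eqv : forall w w', eqv n w w' -> eqv n' (F w) (F w').

Definition state_map_pred (x : state n m) v := exists2 w, rep x w & eqv n' (F w) v.

Lemma state_map_subproof (x : state n m) :
  exists2 w, width n' w = Some m' & state_map_pred x = eqv n' w.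
Proof.
have [w xw] := rep_ex x; exists (F w); first exact/F_width/(rep_width xw).
apply: functional_extensionality => v; apply: propositional_extensionality; split.
  by case=> w' xw'; apply: eqv_trans; apply: F_eqv; apply: rep_inj xw xw'.
by exists w.
Qed.

Definition state_map x : state n' m' := State (state_map_subproof x).

Lemma rep_state_map x w : rep x w -> rep (state_map x) (F w).
Proof. by exists w. Qed.

End StateMap.

Section Act.
Variables (n m i : nat).
Hypothesis le_i : i + 2 <= m.

Lemma act_width c w :
  width n w = Some m -> width n (w ++ [:: (i, Cross c)]) = Some m.
Proof. by move=> ww; rewrite width_cat ww /= le_i; congr Some; lia. Qed.

Definition act c : state n m -> state n m :=
  state_map (act_width c) (@eqv_catr n [:: (i, Cross c)]).

Lemma rep_act c x w : rep x w -> rep (act c x) (w ++ [:: (i, Cross c)]).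
Proof. exact: rep_state_map. Qed.

Lemma actK c : cancel (act c) (act (flip c)).
Proof.
move=> x; have [w xw] := rep_ex x; have ww := rep_width xw.
apply: (state_eq (w := w)) => //; apply: rep_eqv (rep_act _ (rep_act _ xw)) _.
rewrite -catA; have := @eqv_context n w [::] i 2 m _ _ ww le_i (cross_cross c).
by rewrite /shift /= !cats0 addn0.
Qed.

End Act.

Lemma act_braided n m i j (le_i : i + 2 <= m) (le_j : j + 2 <= m) : j = i.+1 ->
  braided (@act n m i le_i) (@act n m j le_j).
Proof.
move=> def_j; subst j; split; [exact: actK | exact: actK | move=> c1 c2 c3 t x].
have [w xw] := rep_ex x; have ww := rep_width xw.
apply: state_eq (rep_act _ _ (rep_act _ _ (rep_act _ _ xw))) _.
apply: rep_eqv (rep_act _ _ (rep_act _ _ (rep_act _ _ xw))) _.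
rewrite -!catA; have le3 : i + 3 <= m by lia.
have := @eqv_context n w [::] i 3 m _ _ ww le3 (eqv_sym (eqv_of_welded (WeldedIII t))).
by rewrite /shift /= !addn0 addn1.
Qed.

Lemma act_far n m i j (le_i : i + 2 <= m) (le_j : j + 2 <= m) c d x : i + 2 <= j ->
  @act n m i le_i c (@act n m j le_j d x) = act le_j d (act le_i c x).
Proof.
move=> lt_ij; have [w xw] := rep_ex x; have ww := rep_width xw.
apply: state_eq (rep_act _ _ (rep_act _ _ xw)) _.
apply: rep_eqv (rep_act _ _ (rep_act _ _ xw)) _.
rewrite -!catA.
have ex := @exchange_pieces (Cross c) (Cross d) (j - (i + 2)).
have le : i + (2 + (j - (i + 2)) + 2) <= m by lia.
have := @eqv_context n w [::] i _ m _ _ ww le ex.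
by rewrite /shift /= !addn0 addnA subnKC.
Qed.

Definition letters (i : nat) (cs : seq crossing) : seq slice :=
  shift i (braid cs).

Definition rl_word (b : bool) : seq crossing :=
  if b then [:: Classical true; Virtual] else [:: Virtual; Classical false].
Definition lr_word (b : bool) : seq crossing :=
  if b then [:: Virtual; Classical true] else [:: Classical false; Virtual].

Section Words.
Variables (n m i : nat) (le_i : i + 2 <= m).
Implicit Type x : state n m.

Lemma rep_rl b x w : rep x w -> rep (rl (act le_i) b x) (w ++ letters i (rl_word b)).
Proof.
move=> xw; rewrite /rl; case: b;
  apply: rep_eqv (rep_act _ _ (rep_act _ _ xw)) _; rewrite -catA /letters /shift /= addn0 //.
Qed.

Lemma rep_lr b x w : rep x w -> rep (lr (act le_i) b x) (w ++ letters i (lr_word b)).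
Proof.
move=> xw; rewrite /lr; case: b;
  apply: rep_eqv (rep_act _ _ (rep_act _ _ xw)) _; rewrite -catA /letters /shift /= addn0 //.
Qed.

Lemma rep_letters cs x w : rep x w ->
  rep (foldl (fun y c => act le_i c y) x cs) (w ++ letters i cs).
Proof.
elim: cs x w => [|c cs IHcs] x w xw /=; first by rewrite /letters shift_nil cats0.
by have := IHcs _ _ (rep_act le_i c xw); rewrite -catA /letters /= shift_cons addn0.
Qed.

End Words.

Lemma turn_turn_hstack A B : width 2 A = Some 2 -> width 2 B = Some 2 ->
  eqv 2 (turn (turn (hstack_slices A B))) (hstack_slices (turn (turn B)) (turn (turn A))).
Proof.
move=> wA wB; apply: eqv_trans (turn_eqv (turn_hstack wA wB)) _.
exact: turn_cat (turn_width wA) (turn_width wB).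
Qed.

Lemma wink_left b c : eqv 2
  (hstack_slices [:: (0, Cross (Classical c))] (braid (rl_word b))) (braid (rl_word b)).
Proof. by apply/eqv_of_wink/Wink; case: b; constructor. Qed.

(** A half turn exchanges left and right and carries [rl_word b] to its reverse [lr_word b]. *)
Lemma wink_right b c : eqv 2
  (hstack_slices (braid (lr_word b)) [:: (0, Cross (Classical c))]) (braid (lr_word b)).
Proof.
have rr : eqv 2 (turn (turn (braid (rl_word b)))) (braid (lr_word b)).
  by case: b; apply: turn_turn_braid.
have rc := turn_turn_braid [:: Classical c].
have wb := braid_width (rl_word b).
apply: (eqv_trans _ rr).
have wt := turn_width (turn_width wb).
apply: eqv_trans (eqv_sym (hstack_eqv wt rr rc)) _.
apply: eqv_trans (eqv_sym (@turn_turn_hstack [:: (0, Cross _)] _ erefl wb)) _.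
exact/turn_eqv/turn_eqv/wink_left.
Qed.

Lemma bend_hstack_left c T : width 2 T = Some 2 ->
  eqv 0 (bend (hstack_slices [:: (0, Cross c)] T)) (bend T ++ [:: (0, Cross (flip c))]).
Proof.
move=> wT; apply: eqv_trans (bend_eqv (eqv_sym (hstack_cross_left c wT))) _.
rewrite /bend.
have ex := @exchange [:: (0, Cap)]
  ([:: (0, Cap); (0, Cap)] ++ shift 1 T ++ [:: (0, Cross (flip c))]) 0 2 0 4 erefl.
have wv : width 0 ([:: (0, Cap); (0, Cap)] ++ shift 1 T ++ [:: (0, Cross (flip c))]) = Some 4.
  by width_simpl.
rewrite_word (Nil slice) 0 [:: (1, Cup)] (ex wv).
rewrite_word ([:: (0, Cap); (0, Cap)] ++ shift 1 T ++ [:: (0, Cross (flip c))])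
  0 (Nil slice) zigzag.
have ex' := @exchange [:: (0, Cap)] [:: (0, Cap)] 0 2 0 2 erefl erefl.
by rewrite_word (Nil slice) 0 (shift 1 T ++ [:: (0, Cross (flip c))]) (eqv_sym ex').
Qed.

Lemma bend_hstack_right c T : width 2 T = Some 2 ->
  eqv 0 (bend (hstack_slices T [:: (0, Cross c)])) (bend T ++ [:: (2, Cross (flip c))]).
Proof.
move=> wT; apply: eqv_trans (bend_eqv (eqv_sym (hstack_cross_right c wT))) _.
rewrite /bend.
have ex' := @exchange [:: (0, Cap)] [:: (0, Cap)] 0 2 0 2 erefl erefl.
rewrite_word [:: (0, Cap)] 2 (shift 1 T ++ [:: (2, Cross (flip c)); (3, Cup)])
  (eqv_sym ex').
have wv : width 4 (shift 1 T ++ [:: (2, Cross (flip c))]) = Some 4 by width_simpl.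
have ex := @exchange _ [:: (0, Cap)] 4 4 0 2 wv erefl.
rewrite_word [:: (0, Cap); (2, Cap)] 0 [:: (3, Cup)] (eqv_sym ex).
by rewrite_word ([:: (0, Cap); (2, Cap)] ++ shift 1 T ++ [:: (2, Cross (flip c))])
  3 (Nil slice) zagzig.
Qed.

(** * The crossings acting on bent tangles *)

Local Notation g0 := (@act 0 4 0 isT).
Local Notation g1 := (@act 0 4 1 isT).
Local Notation g2 := (@act 0 4 2 isT).

Definition two_caps : state 0 4 := @class 0 4 [:: (0, Cap); (2, Cap)] erefl.

Lemma two_caps_square : square g0 g1 g2 two_caps.
Proof.
have caps := rep_classP (erefl : width 0 [:: (0, Cap); (2, Cap)] = Some 4).
have ex := @exchange [:: (0, Cap)] [:: (0, Cap)] 0 2 0 2 erefl erefl.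
have slide0 c : eqv 0 [:: (0, Cap); (2, Cap); (1, Cross c); (0, Cross c)]
    [:: (0, Cap); (1, Cap)].
  rewrite_word (Nil slice) 0 [:: (1, Cross c); (0, Cross c)] ex.
  rewrite_word [:: (0, Cap)] 0 [:: (0, Cross c)] (cap_cross c).
  have cc := cross_cross (flip c); rewrite flipK in cc.
  by rewrite_word [:: (0, Cap); (1, Cap)] 0 (Nil slice) cc.
have slide2 c : eqv 0 [:: (0, Cap); (2, Cap); (1, Cross c); (2, Cross c)]
    [:: (0, Cap); (1, Cap)].
  have cc := eqv_sym (cap_cross (flip c)); rewrite flipK in cc.
  rewrite_word [:: (0, Cap)] 1 [:: (2, Cross c)] cc.
  have cc' := cross_cross (flip c); rewrite flipK in cc'.
  by rewrite_word [:: (0, Cap); (1, Cap)] 2 (Nil slice) cc'.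
split.
- exact: act_braided.
- exact/braided_mirror/act_braided.
- by move=> c d x; apply: act_far.
- split=> c.
  + apply: state_eq (rep_act _ _ caps) _; apply: rep_eqv caps _; apply: eqv_sym.
    rewrite_word (Nil slice) 0 [:: (0, Cross c)] ex.
    rewrite_word [:: (0, Cap)] 0 (Nil slice) (cap_kink c).
    by rewrite_word (Nil slice) 0 (Nil slice) (eqv_sym ex).
  + apply: state_eq (rep_act _ _ (rep_act _ _ caps)) _.
    apply: rep_eqv (rep_act _ _ (rep_act _ _ caps)) _.
    exact: eqv_trans (slide0 _) (eqv_sym (slide0 _)).
- split=> c.
  + apply: state_eq (rep_act _ _ caps) _; apply: rep_eqv caps _; apply: eqv_sym.
    by rewrite_word [:: (0, Cap)] 2 (Nil slice) (cap_kink (flip c)).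
  + apply: state_eq (rep_act _ _ (rep_act _ _ caps)) _.
    apply: rep_eqv (rep_act _ _ (rep_act _ _ caps)) _.
    exact: eqv_trans (slide2 _) (eqv_sym (slide2 _)).
- move=> b c.
  have wb := braid_width (rl_word b).
  have bent : rep (rl g1 b two_caps) (bend (braid (rl_word b))) by exact: (rep_rl _ _ caps).
  apply: state_eq (rep_act _ _ bent) _; apply: rep_eqv bent _.
  have := bend_hstack_left (Classical (~~ c)) wb; rewrite /= negbK.
  exact/eqv_trans/bend_eqv/eqv_sym/wink_left.
- move=> b c.
  have wb := braid_width (lr_word b).
  have bent : rep (lr g1 b two_caps) (bend (braid (lr_word b))) by exact: (rep_lr _ _ caps).
  apply: state_eq (rep_act _ _ bent) _; apply: rep_eqv bent _.
  have := bend_hstack_right (Classical (~~ c)) wb; rewrite /= negbK.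
  exact/eqv_trans/bend_eqv/eqv_sym/wink_right.
Qed.

(** Unbending makes [klein_cap] a relation of tangles, which may then be applied locally in any
    state. *)
Lemma klein_braid b c : eqv 2 (braid (lr_word c ++ rl_word b))
  (braid (rl_word (~~ b) ++ lr_word (~~ c))).
Proof.
have caps := rep_classP (erefl : width 0 [:: (0, Cap); (2, Cap)] = Some 4).
apply: unbend_eqv; [exact: braid_width | exact: braid_width | ].
have bendE cs ds : bend (braid (cs ++ ds)) =
    ([:: (0, Cap); (2, Cap)] ++ letters 1 cs) ++ letters 1 ds.
  by rewrite /bend /letters /braid map_cat shift_cat.
rewrite !bendE; apply: (@rep_inj _ _ (rl g1 b (lr g1 c two_caps))).
  exact: rep_rl (rep_lr _ _ caps).
rewrite (klein_cap two_caps_square).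
exact: rep_lr (rep_rl _ _ caps).
Qed.

Lemma klein_act n m i (le_i : i + 2 <= m) b c (x : state n m) :
  rl (act le_i) b (lr (act le_i) c x) = lr (act le_i) (~~ c) (rl (act le_i) (~~ b) x).
Proof.
have [w xw] := rep_ex x; have ww := rep_width xw.
apply: state_eq (rep_rl _ _ (rep_lr _ _ xw)) _.
apply: rep_eqv (rep_lr _ _ (rep_rl _ _ xw)) _; rewrite -!catA.
have := @eqv_context n w [::] i 2 m _ _ ww le_i (eqv_sym (klein_braid b c)).
by rewrite /braid !map_cat !shift_cat !cats0.
Qed.

(** Straightens the leg TR; as this commutes with the crossings of the first three legs, identities
    on four legs pass to three. *)
Definition close_right : state 0 4 -> state 1 3.
Proof.
apply: (@state_map 0 4 1 3 (fun w => w ++ [:: (3, Cup)])).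
- by move=> w ww; rewrite width_cat -[w]shift0 (@width_at 0 0 1 4).
- move=> w w' e; apply: eqv_catr.
  by have := @eqv_at 1 0 0 _ _ [::] isT e; rewrite !shift0 !cats0.
Defined.

Definition close_left : state 0 4 -> state 1 3.
Proof.
apply: (@state_map 0 4 1 3 (fun w => shift 1 w ++ [:: (0, Cup)])).
- by move=> w ww; rewrite width_cat (@width_at 1 0 1 4).
- by move=> w w' e; apply: (@eqv_at 1 1 0 _ _ _ isT e).
Defined.

Local Notation a0 := (@act 1 3 0 isT).
Local Notation a1 := (@act 1 3 1 isT).

(* The bent trivial tangle with only the top left, respectively top right, corner
   bent down. *)
Definition left_cap : state 1 3 := @class 1 3 [:: (0, Cap)] erefl.
Definition right_cap : state 1 3 := @class 1 3 [:: (1, Cap)] erefl.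

Lemma close_right_act i (le4 : i + 2 <= 4) (le3 : i + 2 <= 3) c x :
  close_right (act le4 c x) = act le3 c (close_right x).
Proof.
have [w xw] := rep_ex x; have ww := rep_width xw.
apply: state_eq (rep_state_map _ _ (rep_act _ _ xw)) _.
apply: rep_eqv (rep_act _ _ (rep_state_map _ _ xw)) _.
rewrite -!catA; have w1 : width 1 w = Some 5.
  by rewrite -[w]shift0 (@width_at 0 0 1 4).
have ex := eqv_sym (@exchange_pieces (Cross c) Cup (3 - (i + 2))).
have le : i + (2 + (3 - (i + 2)) + 2) <= 5 by lia.
have := @eqv_context 1 w [::] i _ 5 _ _ w1 le ex.
rewrite /shift /= !addn0 addnA (_ : i + 2 + (3 - (i + 2)) = 3) //; lia.
Qed.

Lemma close_left_act i (le4 : i.+1 + 2 <= 4) (le3 : i + 2 <= 3) c x :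
  close_left (act le4 c x) = act le3 c (close_left x).
Proof.
have [w xw] := rep_ex x; have ww := rep_width xw.
apply: state_eq (rep_state_map _ _ (rep_act _ _ xw)) _.
apply: rep_eqv (rep_act _ _ (rep_state_map _ _ xw)) _.
rewrite shift_cat -!catA; have w1 : width 1 (shift 1 w) = Some 5.
  by rewrite (@width_at 1 0 1 4).
have ex := @exchange_pieces Cup (Cross c) i.
have le : 0 + (2 + i + 2) <= 5 by lia.
by have := @eqv_context 1 (shift 1 w) [::] 0 _ 5 _ _ w1 le ex.
Qed.

Lemma close_right_caps : close_right two_caps = left_cap.
Proof.
have caps := rep_classP (erefl : width 0 [:: (0, Cap); (2, Cap)] = Some 4).
apply: state_eq (rep_state_map _ _ caps) _.
apply: rep_eqv (rep_classP (erefl : width 1 [:: (0, Cap)] = Some 3)) _.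
apply: eqv_sym; by rewrite_word [:: (0, Cap)] 2 (Nil slice) zigzag.
Qed.

Lemma close_left_caps : close_left two_caps = right_cap.
Proof.
have caps := rep_classP (erefl : width 0 [:: (0, Cap); (2, Cap)] = Some 4).
apply: state_eq (rep_state_map _ _ caps) _.
apply: rep_eqv (rep_classP (erefl : width 1 [:: (1, Cap)] = Some 3)) _.
apply: eqv_sym.
have ex := @exchange [:: (0, Cup)] [:: (1, Cap)] 2 0 1 3 erefl erefl.
rewrite_word [:: (1, Cap)] 0 (Nil slice) (eqv_sym ex).
by rewrite_word (Nil slice) 0 [:: (1, Cap)] zagzig.
Qed.

Definition left_orbit := pure_orbit a1 left_cap.
(** Reflected, so that the results about a cap on the left apply with the legs numbered from the
    right. *)
Definition right_orbit := pure_orbit (mirror a0) right_cap.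

Lemma left_braided : braided a0 a1.
Proof. exact: act_braided. Qed.

Lemma right_braided : braided (mirror a1) (mirror a0).
Proof. exact: braided_mirror left_braided. Qed.

Lemma left_capped : capped a0 a1 left_cap.
Proof.
have rM0 := @close_right_act 0 isT isT; have rM1 := @close_right_act 1 isT isT.
have [cE sE] := capped1 two_caps_square.
by split=> c; rewrite -close_right_caps -!(rM0, rM1) ?cE ?sE.
Qed.

Lemma right_capped : capped (mirror a1) (mirror a0) right_cap.
Proof.
have lM0 := @close_left_act 0 isT isT; have lM1 := @close_left_act 1 isT isT.
have [cE sE] := capped3 two_caps_square; rewrite /mirror in cE sE *.
split=> c; first by rewrite -close_left_caps -lM1 cE.
by rewrite -close_left_caps -!(lM0, lM1) sE.
Qed.

Lemma left_cap_power_lr m :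
  a0 Virtual (power (lr a1) m left_cap) = power (lr a1) (map negb m) left_cap.
Proof.
have rM1 := lr_morph (@close_right_act 1 isT isT).
rewrite -close_right_caps -!(power_morph _ _ rM1) -(@close_right_act 0 isT).
by rewrite (cap_power_lr two_caps_square).
Qed.

Lemma left_q_power_rl b l :
  lr a0 b (power (rl a1) l left_cap) = power (rl a1) (map negb l) left_cap.
Proof.
have rM1 := rl_morph (@close_right_act 1 isT isT).
have rM0 := lr_morph (@close_right_act 0 isT isT).
rewrite -close_right_caps -!(power_morph _ _ rM1) -rM0.
by rewrite (q_power_rl two_caps_square) //; apply: klein_act.
Qed.

Lemma klein_mirror X (h : crossing -> X -> X) :
  (forall b c x, rl h b (lr h c x) = lr h (~~ c) (rl h (~~ b) x)) ->
  forall b c x, rl (mirror h) b (lr (mirror h) c x) =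
    lr (mirror h) (~~ c) (rl (mirror h) (~~ b) x).
Proof. by move=> klein b c x; rewrite !rl_mirror !lr_mirror klein !negbK. Qed.

Lemma right_cap_power_lr m :
  mirror a1 Virtual (power (lr (mirror a0)) m right_cap) =
  power (lr (mirror a0)) (map negb m) right_cap.
Proof.
have lM0 : forall c x, close_left (mirror g1 c x) = mirror a0 c (close_left x).
  by move=> c x; apply: close_left_act.
have lM1 : forall c x, close_left (mirror g2 c x) = mirror a1 c (close_left x).
  by move=> c x; apply: close_left_act.
rewrite -close_left_caps -!(power_morph _ _ (lr_morph lM0)) -lM1.
by rewrite (cap_power_lr (square_mirror two_caps_square)).
Qed.

Lemma right_q_power_rl b l :
  lr (mirror a1) b (power (rl (mirror a0)) l right_cap) =
  power (rl (mirror a0)) (map negb l) right_cap.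
Proof.
have lM0 : forall c x, close_left (mirror g1 c x) = mirror a0 c (close_left x).
  by move=> c x; apply: close_left_act.
have lM1 : forall c x, close_left (mirror g2 c x) = mirror a1 c (close_left x).
  by move=> c x; apply: close_left_act.
rewrite -close_left_caps -!(power_morph _ _ (rl_morph lM0)) -(lr_morph lM1).
rewrite (q_power_rl (square_mirror two_caps_square)) //.
exact/klein_mirror/klein_act.
Qed.

(** * Pure braids under stacking, odd braids under quarter turns *)

Lemma letters_cat i cs ds : letters i (cs ++ ds) = letters i cs ++ letters i ds.
Proof. by rewrite /letters /braid map_cat shift_cat. Qed.

Lemma foldl_even X (O : X -> Prop) (h : crossing -> X -> X) e cs :
  O e -> (forall c1 c2 x, O x -> O (h c2 (h c1 x))) -> ~~ odd (size cs) ->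
  O (foldl (fun y c => h c y) e cs).
Proof.
move=> Oe Oh; have [n] := ubnP (size cs); elim: n e cs Oe => // n IHn e.
case=> [|c1 [|c2 cs]] //= Oe lt_n; rewrite negbK; apply: IHn; last by lia.
exact: Oh.
Qed.

Section OrbitRep.
Variables (n m i : nat) (le_i : i + 2 <= m) (e : state n m) (w : seq slice).
Hypothesis ew : rep e w.

Local Notation even_rep x :=
  (exists2 cs, ~~ odd (size cs) & rep (x : state n m) (w ++ letters i cs)).

Lemma power_even_rep F l x :
  (forall b y u, rep y u ->
     exists2 cs, size cs = 2 & rep (F b y) (u ++ letters i cs)) ->
  even_rep x -> even_rep (power F l x).
Proof.
move=> Frep; elim: l x => //= b l IHl x [cs ev xcs]; apply: IHl.
have [ds sz yds] := Frep b _ _ xcs.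
by exists (cs ++ ds); rewrite ?size_cat ?oddD ?sz ?addbF // letters_cat catA.
Qed.

Lemma pure_orbit_rep x : pure_orbit (act le_i) e x -> even_rep x.
Proof.
case=> l [k ->]; apply: power_even_rep => [b y u yu|].
  by exists (lr_word b); [case: b | apply: rep_lr].
apply: power_even_rep => [b y u yu|].
  by exists (rl_word b); [case: b | apply: rep_rl].
by exists [::]; rewrite // cats0.
Qed.

Lemma pure_orbit_mirror_rep x : pure_orbit (mirror (act le_i)) e x -> even_rep x.
Proof.
case=> l [k ->]; apply: power_even_rep => [b y u yu|].
  by exists (rl_word (~~ b)); [case: b | rewrite lr_mirror; apply: rep_rl].
apply: power_even_rep => [b y u yu|].
  by exists (lr_word (~~ b)); [case: b | rewrite rl_mirror; apply: rep_lr].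
by exists [::]; rewrite // cats0.
Qed.

End OrbitRep.

Lemma left_pure cs : ~~ odd (size cs) ->
  left_orbit (foldl (fun y c => a1 c y) left_cap cs).
Proof.
apply: foldl_even; first exact: pure_orbit_base.
move=> c1 c2 x; exact: (pure_orbit_pair left_braided (@klein_act _ _ _ _)).
Qed.

Lemma right_pure cs : ~~ odd (size cs) ->
  right_orbit (foldl (fun y c => a0 c y) right_cap cs).
Proof.
apply: foldl_even; first exact: pure_orbit_base.
move=> c1 c2 x Ox; rewrite -[c1]flipK -[c2]flipK.
exact: (pure_orbit_pair right_braided (klein_mirror (@klein_act _ _ _ _)) (flip c1) (flip c2)).
Qed.

Lemma left_capP : rep left_cap [:: (0, Cap)].
Proof. exact: rep_classP. Qed.
Lemma right_capP : rep right_cap [:: (1, Cap)].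
Proof. exact: rep_classP. Qed.

Lemma unbend_left_eqv u v : eqv 1 u v ->
  eqv 2 (shift 1 u ++ [:: (0, Cup)]) (shift 1 v ++ [:: (0, Cup)]).
Proof. exact: (@eqv_at 2 1 1 _ _ _ isT). Qed.

(** With TL bent down, even braids are the states of [left_orbit], and this orbit is stable under
    crossings of TL and BL. *)
Lemma hstack_pure_left c cs : ~~ odd (size cs) ->
  exists2 ds, ~~ odd (size ds) &
    eqv 2 (hstack_slices [:: (0, Cross c)] (braid cs)) (braid ds).
Proof.
move=> ev; set x := foldl (fun y c => a1 c y) left_cap cs.
have Oy : left_orbit (a0 (flip c) x).
  exact: (pure_orbit_letter left_braided left_capped (@klein_act _ _ _ _)
    left_cap_power_lr left_q_power_rl _ (left_pure ev)).
have [ds evd yds] := pure_orbit_rep left_capP Oy.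
have xcs : rep x ([:: (0, Cap)] ++ letters 1 cs) := rep_letters _ cs left_capP.
have ycs : rep (a0 (flip c) x) (([:: (0, Cap)] ++ letters 1 cs) ++
  [:: (0, Cross (flip c))]) := rep_act _ _ xcs.
exists ds => //; have e := unbend_left_eqv (rep_inj ycs yds).
apply: eqv_trans (eqv_sym (hstack_cross_left c (braid_width cs))) _.
apply: eqv_trans _ (unbend_left (braid_width ds)).
by move: e; rewrite /letters; flatten_word.
Qed.

Lemma hstack_pure_right c cs : ~~ odd (size cs) ->
  exists2 ds, ~~ odd (size ds) &
    eqv 2 (hstack_slices (braid cs) [:: (0, Cross c)]) (braid ds).
Proof.
move=> ev; set x := foldl (fun y c => a0 c y) right_cap cs.
have Oy : right_orbit (mirror a1 c x).
  exact: (pure_orbit_letter right_braided right_capped (klein_mirror (@klein_act _ _ _ _))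
    right_cap_power_lr right_q_power_rl _ (right_pure ev)).
have [ds evd yds] := pure_orbit_mirror_rep right_capP Oy.
have xcs : rep x ([:: (1, Cap)] ++ letters 0 cs) := rep_letters _ cs right_capP.
have ycs : rep (mirror a1 c x) (([:: (1, Cap)] ++ letters 0 cs) ++
  [:: (1, Cross (flip c))]) := rep_act _ _ xcs.
exists ds => //; have e := rep_inj ycs yds.
apply: eqv_trans (eqv_sym (hstack_cross_right c (braid_width cs))) _.
apply: eqv_trans _ (unbend_right (braid_width ds)).
have := @eqv_at 2 0 1 _ _ [:: (2, Cup)] isT e; rewrite /letters.
by flatten_word.
Qed.

(** One virtual crossing makes the braid pure, a product of arrows on the left cap. The virtually
    crossed left and right caps agree, so [pure_orbit_across] rewrites these arrows on the right
    cap, where a braid unbends to a quarter turn. *)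
Lemma braid_turn cs : odd (size cs) ->
  exists2 ds, odd (size ds) & eqv 2 (braid cs) (turn (braid ds)).
Proof.
case/lastP: cs => // cs c; rewrite size_rcons /= => ev.
set x := foldl (fun y c => a1 c y) left_cap (rcons cs c).
have VK1 : involutive (a1 Virtual) := @actK 1 3 1 isT Virtual.
have VK0 : involutive (a0 Virtual) := @actK 1 3 0 isT Virtual.
have [l [m def_x]] : left_orbit (a1 Virtual x).
  rewrite /x -cats1 foldl_cat /=.
  exact: (pure_orbit_pair left_braided (@klein_act _ _ _ _) c Virtual (left_pure ev)).
have caps : a1 Virtual left_cap = a0 Virtual right_cap.
  apply: state_eq (rep_act _ _ left_capP) _.
  apply: rep_eqv (rep_act _ _ right_capP) (eqv_sym (cap_cross Virtual)).
have Oy : right_orbit (a0 Virtual x).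
  rewrite -[x]VK1 def_x (power_conj m _ VK1).1 (power_conj l _ VK1).2 caps.
  have := pure_orbit_across right_braided right_capped (klein_mirror (@klein_act _ _ _ _))
    right_cap_power_lr right_q_power_rl (map negb l) (map negb m).
  rewrite !power_neg (eq_power (G := rl a1)); last first.
    by move=> b y; rewrite lr_mirror negbK.
  rewrite (eq_power (F := fun b => rl _ (~~ b)) (G := lr a1)); last by move=> b y; rewrite rl_mirror negbK.
  exact.
have [ds evd yds] := pure_orbit_mirror_rep right_capP Oy.
have xds : rep x (([:: (1, Cap)] ++ letters 0 ds) ++ [:: (0, Cross Virtual)]).
  by rewrite -[x]VK0; apply: rep_act.
have xcs : rep x ([:: (0, Cap)] ++ letters 1 (rcons cs c)) := rep_letters _ _ left_capP.
(* The last virtual crossing undoes the [a0 Virtual] that brought [x] into [right_orbit]. *)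
exists (rcons ds Virtual); first by rewrite size_rcons.
apply: eqv_trans (eqv_sym (unbend_left (braid_width (rcons cs c)))) _.
have := unbend_left_eqv (rep_inj xcs xds).
by rewrite /letters /braid !map_rcons -!cats1; flatten_word.
Qed.

Hint Resolve braid_width : core.

(** Four quarter turns act trivially on braids, so three more turns invert the one given by
    [braid_turn] for the reversed braid. *)
Lemma turn_braid cs : odd (size cs) ->
  exists2 ds, odd (size ds) & eqv 2 (turn (braid cs)) (braid ds).
Proof.
move=> od; have [|ds odd_ds e] := @braid_turn (rev cs); first by rewrite size_rev.
have tt := turn_turn_braid.
have turn4 es : eqv 2 (turn (turn (turn (turn (braid es))))) (braid es).
  apply: eqv_trans (turn_eqv (turn_eqv (tt es))) _.
  by have := tt (rev es); rewrite revK.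
exists ds => //; apply: eqv_trans (eqv_sym (turn_eqv (turn4 cs))) _.
apply: eqv_trans (turn_eqv (turn_eqv (turn_eqv (tt cs)))) _.
exact: eqv_trans (turn_eqv (turn_eqv (turn_eqv e))) (turn4 ds).
Qed.

Lemma turn_braid_cons c cs : eqv 2 (turn (braid (c :: cs)))
  (hstack_slices (turn (braid cs)) [:: (0, Cross (flip c))]).
Proof.
apply: eqv_trans (@turn_cat [:: (0, Cross c)] _ erefl (braid_width cs)) _.
by apply: hstack_eqv => //; [apply: turn_width | apply: turn_cross].
Qed.

(** The first crossing of [cs] is the rightmost piece of the turned braid; it is adjacent to
    [braid ds], which absorbs it by [hstack_pure_left]. *)
Lemma turn_hstack_pure cs ds : ~~ odd (size ds) ->
  exists2 es, ~~ odd (size es) &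
    eqv 2 (hstack_slices (turn (braid cs)) (braid ds)) (braid es).
Proof.
elim: cs ds => [|c cs IHcs] ds ev.
  by exists ds => //; apply: hstack0l.
have [ds' ev' e] := hstack_pure_left (flip c) ev.
have [es ev'' e'] := IHcs ds' ev'; exists es => //.
have wt := turn_width (braid_width cs).
apply: eqv_trans (hstack_eqv _ (turn_braid_cons c cs) (eqv_refl _ _)) _.
  exact: turn_width.
apply: eqv_trans (eqv_sym (@hstackA _ [:: (0, Cross (flip c))] _ wt erefl (braid_width ds))) _.
exact: eqv_trans (hstack_eqv wt (eqv_refl _ _) e) e'.
Qed.

Lemma hstack_turn_pure cs ds : ~~ odd (size ds) ->
  exists2 es, ~~ odd (size es) &
    eqv 2 (hstack_slices (braid ds) (turn (braid cs))) (braid es).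
Proof.
move=> ev; elim: cs => [|c cs [ds' ev' e]].
  by exists ds => //; apply: hstack0r.
have [es ev'' e'] := hstack_pure_right (flip c) ev'; exists es => //.
have wt := turn_width (braid_width cs).
apply: eqv_trans (hstack_eqv (braid_width ds) (eqv_refl _ _) (turn_braid_cons c cs)) _.
apply: eqv_trans (@hstackA _ _ [:: (0, Cross (flip c))] (braid_width ds) wt erefl) _.
apply: eqv_trans (hstack_eqv _ e (eqv_refl _ _)) e'.
exact: hstack_width.
Qed.

(** * Normal forms of algebraic tangles *)

Inductive connectivity := Vertical | Horizontal | Diagonal.

Definition normal (t : connectivity) (T : seq slice) : Prop :=
  match t with
  | Vertical => exists2 cs, ~~ odd (size cs) & eqv 2 T (braid cs)
  | Horizontal => exists2 cs, ~~ odd (size cs) & eqv 2 T (turn (braid cs))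
  | Diagonal => exists2 cs, odd (size cs) & eqv 2 T (braid cs)
  end.

Definition vconnect (s t : connectivity) : connectivity :=
  match s, t with
  | Horizontal, _ | _, Horizontal => Horizontal
  | Vertical, r | r, Vertical => r
  | Diagonal, Diagonal => Vertical
  end.

Definition hconnect (s t : connectivity) : connectivity :=
  match s, t with
  | Vertical, _ | _, Vertical => Vertical
  | Horizontal, r | r, Horizontal => r
  | Diagonal, Diagonal => Horizontal
  end.

Lemma braid_cat cs ds : braid (cs ++ ds) = braid cs ++ braid ds.
Proof. exact: map_cat. Qed.

Lemma normal_turn t T : normal t T -> t <> Vertical ->
  exists2 cs, odd (size cs) = (if t is Diagonal then true else false) &
    eqv 2 T (turn (braid cs)).
Proof.
case: t => [_ /(_ erefl)//|[cs ev e] _|[cs od e] _].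
  by exists cs; first exact: negbTE.
by have [ds od' e'] := braid_turn od; exists ds; last exact: eqv_trans e e'.
Qed.

Lemma normal_braid t T : normal t T -> t <> Horizontal ->
  exists2 cs, odd (size cs) = (if t is Diagonal then true else false) &
    eqv 2 T (braid cs).
Proof.
by case: t => [[cs ev e] _|_ /(_ erefl)//|[cs od e] _]; exists cs => //; apply: negbTE.
Qed.

Section NormalStack.
Variables (S T : seq slice) (s t : connectivity).
Hypotheses (wS : width 2 S = Some 2) (wT : width 2 T = Some 2).
Hypotheses (nS : normal s S) (nT : normal t T).

(** A vertical factor is a pure braid that absorbs the turned braid beside it. Otherwise both
    factors are turned braids, which concatenate; the parity decides between horizontal and
    diagonal. *)
Lemma normal_hstack : ~ (s = Vertical /\ t = Vertical) ->
  normal (hconnect s t) (hstack_slices S T).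
Proof.
move=> notVV; have [sV|sV] : s = Vertical \/ s <> Vertical by case: (s); [left|right|right].
  have [|ds _ e'] := normal_turn nT; first by move=> tV; apply: notVV.
  have [|cs ev e] := normal_braid nS; first by rewrite sV.
  have [|es ev' e''] := @hstack_turn_pure ds cs; first by rewrite ev sV.
  rewrite sV /=; exists es => //.
  exact: eqv_trans (hstack_eqv wS e e') e''.
have [cs od e] := normal_turn nS sV.
have [tV|tV] : t = Vertical \/ t <> Vertical by case: (t); [left|right|right].
  have [|ds ev e'] := normal_braid nT; first by rewrite tV.
  have [|es ev' e''] := @turn_hstack_pure cs ds; first by rewrite ev tV.
  suff : normal Vertical (hstack_slices S T) by rewrite tV; case: (s).
  by exists es => //; apply: eqv_trans (hstack_eqv wS e e') e''.
have [ds od' e'] := normal_turn nT tV.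
have e'' : eqv 2 (hstack_slices S T) (turn (braid (ds ++ cs))).
  rewrite braid_cat; apply: eqv_trans (hstack_eqv wS e e') _.
  exact: eqv_sym (turn_cat (braid_width ds) (braid_width cs)).
have odE : odd (size (ds ++ cs)) = odd (size ds) (+) odd (size cs).
  by rewrite size_cat oddD.
have [od''|ev''] := boolP (odd (size (ds ++ cs))).
  have [es ode e3] := turn_braid od''.
  suff : normal Diagonal (hstack_slices S T).
    by move: od'' sV tV; rewrite odE od od'; case: (s) => //; case: (t).
  by exists es => //; apply: eqv_trans e'' e3.
suff : normal Horizontal (hstack_slices S T).
  by move: ev'' sV tV; rewrite odE od od'; case: (s) => //; case: (t).
by exists (ds ++ cs).
Qed.

(** A braid is the half turn of its reverse, so a quarter turn reduces a stack with one horizontal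
    factor to the horizontal stackings above. *)
Lemma normal_vstack : ~ (s = Horizontal /\ t = Horizontal) ->
  normal (vconnect s t) (S ++ T).
Proof.
move=> notHH; have tt cs : eqv 2 (braid cs) (turn (turn (braid (rev cs)))).
  by apply: eqv_sym; have := turn_turn_braid (rev cs); rewrite revK.
have [sH|sH] : s = Horizontal \/ s <> Horizontal by case: (s); [right|left|right].
  have [|cs ev e] := normal_turn nS; first by rewrite sH.
  have [|ds _ e'] := normal_braid nT; first by move=> tH; apply: notHH.
  have [|es ev' e''] := @hstack_turn_pure (rev ds) cs; first by rewrite ev sH.
  rewrite sH /=; exists es => //.
  apply: eqv_trans (cat_eqv wS e (eqv_trans e' (tt ds))) _.
  apply: eqv_trans (eqv_sym (turn_hstack (braid_width cs) _)) (turn_eqv e'').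
  exact: turn_width.
have [cs od e] := normal_braid nS sH.
have [tH|tH] : t = Horizontal \/ t <> Horizontal by case: (t); [right|left|right].
  have [|ds ev e'] := normal_turn nT; first by rewrite tH.
  have [|es ev' e''] := @turn_hstack_pure (rev cs) ds; first by rewrite ev tH.
  suff : normal Horizontal (S ++ T) by rewrite tH; case: (s).
  exists es => //; apply: eqv_trans (cat_eqv wS (eqv_trans e (tt cs)) e') _.
  apply: eqv_trans (eqv_sym (turn_hstack _ (braid_width ds))) (turn_eqv e'').
  exact: turn_width.
have [ds od' e'] := normal_braid nT tH.
have e'' : eqv 2 (S ++ T) (braid (cs ++ ds)) by rewrite braid_cat; apply: cat_eqv.
have odE : odd (size (cs ++ ds)) = odd (size cs) (+) odd (size ds).
  by rewrite size_cat oddD.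
have [od''|ev''] := boolP (odd (size (cs ++ ds))).
  suff : normal Diagonal (S ++ T).
    by move: od'' sH tH; rewrite odE od od'; case: (s) => //; case: (t).
  by exists (cs ++ ds).
suff : normal Vertical (S ++ T).
  by move: ev'' sH tH; rewrite odE od od'; case: (s) => //; case: (t).
by exists (cs ++ ds).
Qed.

End NormalStack.

(** The top crossing lies directly below the closing cap, so it is a removable kink. *)
Lemma hclosure_braid cs : eqv 0 (hclosure_slices (braid cs)) unknot.
Proof.
elim: cs => [|c cs IHcs]; first exact: eqv_refl.
apply: eqv_trans IHcs.
by rewrite_word (Nil slice) 0 (braid cs ++ [:: (0, Cup)]) (cap_kink c).
Qed.

Lemma vclosure_turn T : width 2 T = Some 2 ->
  eqv 0 (vclosure_slices (turn T)) (hclosure_slices T).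
Proof.
move=> wT; rewrite /vclosure_slices /hclosure_slices.
have ex1 := @exchange [:: (0, Cup)] [:: (1, Cup)] 2 0 3 1 erefl erefl.
rewrite_word ([:: (0, Cap); (2, Cap); (3, Cap)] ++ shift 2 T) 1 [:: (0, Cup)] ex1.
have ex2 := @exchange T [:: (0, Cup)] 2 2 2 0 wT erefl.
rewrite_word [:: (0, Cap); (2, Cap); (3, Cap)] 2 [:: (1, Cup); (0, Cup)] ex2.
rewrite_word [:: (0, Cap); (2, Cap)] 3 (shift 2 T ++ [:: (1, Cup); (0, Cup)]) zigzag.
have ex3 := @exchange [:: (0, Cap)] ((0, Cap) :: T) 0 2 0 2 erefl wT.
rewrite_word (Nil slice) 0 [:: (1, Cup); (0, Cup)] ex3.
by rewrite_word ((0, Cap) :: T) 0 [:: (0, Cup)] zigzag.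
Qed.

(** * Colourings of the components *)

Inductive colored_slice : slice -> seq bool -> seq bool -> Prop :=
| ColoredCap p x q : colored_slice (size p, Cap) (p ++ q) (p ++ [:: x, x & q])
| ColoredCup p x q : colored_slice (size p, Cup) (p ++ [:: x, x & q]) (p ++ q)
| ColoredCross p c x y q :
    colored_slice (size p, Cross c) (p ++ [:: x, y & q]) (p ++ [:: y, x & q]).

(** [a] colours the top line and [ls] the lines below the successive slices, so entry k of [a :: ls]
    colours the line above slice k. *)
Fixpoint colored (a : seq bool) (w : seq slice) (ls : seq (seq bool)) : Prop :=
  match w, ls with
  | [::], [::] => True
  | x :: w', b :: ls' => colored_slice x a b /\ colored b w' ls'
  | _, _ => False
  end.

Lemma colored_cat a u v ls ls' :
  colored a u ls -> colored (last a ls) v ls' -> colored a (u ++ v) (ls ++ ls').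
Proof.
elim: u a ls => [|x u IHu] a [|b ls] //= [ab bu] lv; split => //.
exact: IHu.
Qed.

Lemma colored_shift p q a w ls : colored a w ls ->
  colored (p ++ a ++ q) (shift (size p) w) [seq p ++ b ++ q | b <- ls].
Proof.
elim: w a ls => [|z w IHw] a [|b ls] //= [ab bw]; split; last exact: IHw.
by case: ab => [r x s|r x s|r c x y s]; rewrite /= -size_cat -!catA !(catA p); constructor.
Qed.

Lemma colored_onth a w ls k x : colored a w ls -> onth w k = Some x ->
  colored_slice x (nth [::] (a :: ls) k) (nth [::] ls k).
Proof.
elim: w a ls k => [|y w IHw] a [|b ls] [|k] //= [ab bw]; first by case=> <-.
exact: IHw.
Qed.

Lemma colored_slice_width x a b : colored_slice x a b -> forall w,
  width (size a) (x :: w) = width (size b) w.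
Proof.
case=> [p y q|p y q|p c y z q] w /=; rewrite !size_cat /= ifT; try congr width; lia.
Qed.

Lemma colored_width a w ls k : colored a w ls -> k <= size w ->
  width (size a) (take k w) = Some (size (nth [::] (a :: ls) k)).
Proof.
elim: w a ls k => [|y w IHw] a [|b ls] [|k] // [ab bw] le_k.
by rewrite [take _ _]/= (colored_slice_width ab) (IHw _ _ _ bw).
Qed.

Lemma colored_size a w ls : colored a w ls -> size ls = size w.
Proof. by elim: w a ls => [|y w IHw] a [|b ls] //= [_ /IHw->]. Qed.

Lemma nth_cat_add (p r : seq bool) j : nth false (p ++ r) (size p + j) = nth false r j.
Proof. by rewrite nth_cat ltnNge leq_addr /= addKn. Qed.

Lemma slice_arc_color a w ls x y : colored a w ls -> slice_arc w x y ->
  nth false (nth [::] (a :: ls) x.1) x.2 = nth false (nth [::] (a :: ls) y.1) y.2.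
Proof.
have nth0 p r : nth false (p ++ r) (size p) = nth false r 0.
  by rewrite -[size p]addn0 nth_cat_add.
have nth1 p r : nth false (p ++ r) (size p).+1 = nth false r 1.
  by rewrite -addn1 nth_cat_add.
move=> col; case=> [k i g s wk lt_s|k i g s wk|k i wk|k i wk|k i c wk|k i c wk];
  have := colored_onth col wk; rewrite /=;
  move: (nth [::] (a :: ls) k) (nth [::] ls k) => u v sl; inversion sl; subst;
  (* The offset in [ArcRight] is unbounded; beyond the line both ends read the default [false]. *)
  by rewrite ?nth0 ?nth1 // -?addnA ?nth_cat_add // !nth_cat lt_s.
Qed.

(** Colours are constant along arcs, so points of different colours cannot be connected. *)
Lemma colored_not_knot (D : diagram 0 0) ls : colored [::] D ls ->
  (forall b : bool, has (fun l => b \in l) ls) -> ~ is_knot D.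
Proof.
move=> col hit [_ conn].
have point b : exists2 x, is_point D x & nth false (nth [::] ([::] :: ls) x.1) x.2 = b.
  have /hasP[l l_ls b_l] := hit b.
  have lt_k : index l ls < size D by rewrite -(colored_size col) index_mem.
  exists ((index l ls).+1, index b l) => /=; last by rewrite !nth_index.
  split=> //=; exists (size l); last by rewrite index_mem.
  by have := colored_width col lt_k; rewrite /= nth_index.
have [x xD x_true] := point true; have [y yD y_false] := point false.
suff : nth false (nth [::] ([::] :: ls) x.1) x.2 =
    nth false (nth [::] ([::] :: ls) y.1) y.2 by rewrite x_true y_false.
elim: (conn x y xD yD) => // [u v|u v w _ -> _ ->//].
exact: slice_arc_color.
Qed.

Definition matches (t : connectivity) (a1 a2 b1 b2 : bool) : bool :=
  match t with
  | Vertical => (a1 == b1) && (a2 == b2)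
  | Horizontal => (a1 == a2) && (b1 == b2)
  | Diagonal => (a1 == b2) && (a2 == b1)
  end.

(* Colourings of the components of T exist for all matching colours of the
   corners; if [closed], T has a closed component, of arbitrary colour. *)
Definition paint (closed : bool) (t : connectivity) (T : seq slice) : Prop :=
  forall a1 a2 b1 b2 x, matches t a1 a2 b1 b2 ->
  exists ls, [/\ colored [:: a1; a2] T ls, last [:: a1; a2] ls = [:: b1; b2] &
    closed -> has (fun l => x \in l) ([:: a1; a2] :: ls)].

Definition is_vertical t := if t is Vertical then true else false.
Definition is_horizontal t := if t is Horizontal then true else false.

(** Two horizontal pieces close up a component through the middle line, which may take any colour x.
    The rest is a finite check. *)
Lemma vconnect_matches s t a1 a2 b1 b2 x :
  matches (vconnect s t) a1 a2 b1 b2 -> exists c1 c2,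
  [/\ matches s a1 a2 c1 c2, matches t c1 c2 b1 b2 &
      is_horizontal s && is_horizontal t -> c1 = x].
Proof.
move: a1 a2 b1 b2 x; case: s; case: t => -[] [] [] [] [] //= _;
  first [by exists true, true | by exists true, false
        | by exists false, true | by exists false, false].
Qed.

Lemma hconnect_matches s t a1 a2 b1 b2 x :
  matches (hconnect s t) a1 a2 b1 b2 -> exists c d,
  [/\ matches s a1 c b1 d, matches t c a2 d b2 &
      is_vertical s && is_vertical t -> c = x].
Proof.
move: a1 a2 b1 b2 x; case: s; case: t => -[] [] [] [] [] //= _;
  first [by exists true, true | by exists true, false
        | by exists false, true | by exists false, false].
Qed.

Lemma paint_vstack f g s t S T : paint f s S -> paint g t T ->
  paint [|| f, g | is_horizontal s && is_horizontal t] (vconnect s t) (S ++ T).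
Proof.
move=> pS pT a1 a2 b1 b2 x /(vconnect_matches x)[c1 [c2 [mS mT cx]]].
have [ls [colS lastS hitS]] := pS _ _ _ _ x mS.
have [ls' [colT lastT hitT]] := pT _ _ _ _ x mT.
exists (ls ++ ls'); split.
- by apply: colored_cat; rewrite ?lastS.
- by rewrite last_cat lastS.
(* The colour x of T may be found on the top line of T, which is the last line of S. *)
have hit_mid : x \in [:: c1; c2] -> has (fun l => x \in l) ([:: a1; a2] :: ls).
  by rewrite -lastS => hit; apply/hasP; exists (last [:: a1; a2] ls); first exact: mem_last.
case/or3P=> [/hitS|/hitT|/cx def_c]; rewrite -cat_cons has_cat; first by move->.
  by rewrite [X in X -> _]/= => /orP[/hit_mid->|->]; rewrite ?orbT.
by rewrite hit_mid // def_c mem_head.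
Qed.

Lemma has_map_cat (x : bool) p q ls : has (fun l => x \in l) ls ->
  has (fun l => x \in l) [seq p ++ b ++ q | b <- ls].
Proof.
by rewrite has_map; apply: sub_has => l /= xl; rewrite !mem_cat xl orbT.
Qed.

Lemma paint_hstack f g s t S T : paint f s S -> paint g t T ->
  paint [|| f, g | is_vertical s && is_vertical t] (hconnect s t) (hstack_slices S T).
Proof.
move=> pS pT a1 a2 b1 b2 x /(hconnect_matches x)[c [d [mS mT cx]]].
have [ls [colS lastS hitS]] := pS _ _ _ _ x mS.
have [ls' [colT lastT hitT]] := pT _ _ _ _ x mT.
have colS' := colored_shift [::] [:: c; a2] colS.
have colT' := colored_shift [:: b1; d] [::] colT.
have lastS' : last [:: a1; c; c; a2] [seq [::] ++ b ++ [:: c; a2] | b <- ls] =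
    [:: b1; d; c; a2].
  by rewrite (last_map (fun b => [::] ++ b ++ [:: c; a2]) ls [:: a1; c]) lastS.
have lastT' : last [:: b1; d; c; a2] [seq [:: b1; d] ++ b ++ [::] | b <- ls'] =
    [:: b1; d; d; b2].
  by rewrite (last_map (fun b => [:: b1; d] ++ b ++ [::]) ls' [:: c; a2]) lastT.
set L1 := [seq _ | b <- ls] in lastS' colS' *.
set L2 := [seq _ | b <- ls'] in lastT' colT' *.
exists (([:: a1; c; c; a2] :: L1) ++ L2 ++ [:: [:: b1; b2]]); split.
- split; first exact: (ColoredCap [:: a1] c [:: a2]).
  apply: (@colored_cat _ S (shift 2 T ++ [:: (1, Cup)]) L1 (L2 ++ [:: [:: b1; b2]])).
    by rewrite -[S]shift0; exact: colS'.
  rewrite lastS'; apply: colored_cat; first exact: colT'.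
  by rewrite lastT'; split=> //; apply: (ColoredCup [:: b1] d [:: b2]).
- by rewrite /= !last_cat.
move=> hit; rewrite -cat1s !has_cat; apply/orP; right.
case/or3P: hit => [/hitS|/hitT|/cx def_c].
- by move/(has_map_cat [::] [:: c; a2]) => ->.
- move/(has_map_cat [:: b1; d] [::]); rewrite -/L2 [X in X -> _]/= => /orP[hit|->]; last first.
    by rewrite !orbT.
  apply/orP; left; apply/hasP; exists (last [:: a1; c; c; a2] L1); first exact: mem_last.
  by rewrite lastS'; rewrite !inE in hit *.
by rewrite /= def_c !inE eqxx !orbT.
Qed.

(** A closed component persists under stacking. Without one, the stackings excluded from the normal
    forms do not occur, since they would create it. *)
Lemma algebraic_normal T : algebraic T ->
  exists t closed, paint closed t T /\ (closed \/ normal t T).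
Proof.
have cross_normal c : exists t closed, paint closed t [:: (0, Cross c)] /\ 
    (closed \/ normal t [:: (0, Cross c)]).
  exists Diagonal, false; split; last by right; exists [:: c].
  move=> a1 a2 b1 b2 x /andP[/eqP-> /eqP->]; exists [:: [:: b1; b2]].
  by split=> //; split=> //; apply: (ColoredCross [::] c b2 b1 [::]).
elim=> [|||S {}T _ [s [f [pS nS]]] _ [t [g [pT nT]]]|
          S {}T _ [s [f [pS nS]]] _ [t [g [pT nT]]]].
- exact: cross_normal.
- exact: cross_normal.
- exact: cross_normal.
- exists (vconnect s t), [|| f, g | is_horizontal s && is_horizontal t].
  split; first exact: paint_vstack.
  case: nS => [->|nS]; [by left | case: nT => [->|nT]; first by rewrite orbT; left].
  case hh: (is_horizontal s && is_horizontal t); first by rewrite !orbT; left.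
  right; apply: normal_vstack => //; try exact/eqP/slicesP.
  by case=> sH tH; rewrite sH tH in hh.
- exists (hconnect s t), [|| f, g | is_vertical s && is_vertical t].
  split; first exact: paint_hstack.
  case: nS => [->|nS]; [by left | case: nT => [->|nT]; first by rewrite orbT; left].
  case hh: (is_vertical s && is_vertical t); first by rewrite !orbT; left.
  right; apply: normal_hstack => //; try exact/eqP/slicesP.
  by case=> sH tH; rewrite sH tH in hh.
Qed.

Lemma vclosure_not_knot closed t (T : virtual_tangle) : paint closed t T ->
  closed \/ t = Vertical -> ~ is_knot (vclosure T).
Proof.
move=> pT split_T.
have [y [ls [colT lastT hitT]]] : exists y ls,
    [/\ colored [:: false; y] T ls, last [:: false; y] ls = [:: false; y] &
      has (fun l => true \in l) ([:: false; y] :: ls)].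
  case: split_T pT => [->|->] pT.
    (* All corners get [false] and the closed component gets [true]. *)
    have [|ls [? ? hit]] := pT false false false false true; first by case: (t).
    by exists false, ls; split=> //; apply: hit.
  (* The left and right strands close up separately and get different colours. *)
  have [//|ls [? ? _]] := pT false true false true true.
  by exists true, ls; split.
have colT' := colored_shift [:: false] [:: y] colT.
set L := [seq _ | b <- ls] in colT'.
have lastL : last [:: false; false; y; y] L = [:: false; false; y; y].
  by rewrite (last_map (fun b => [:: false] ++ b ++ [:: y]) ls [:: false; y]) lastT.
apply: (@colored_not_knot _
  ([:: [:: false; false]; [:: false; false; y; y]] ++ L ++ [:: [:: false; false]; [::]])).
  split; first exact: (ColoredCap [::] false [::]).
  split; first exact: (ColoredCap [:: false; false] y [::]).
  apply: colored_cat colT' _; rewrite lastL.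
  split; first exact: (ColoredCup [:: false; false] y [::]).
  by split=> //; apply: (ColoredCup [::] false [::]).
case=> //=; move/(has_map_cat [:: false] [:: y]): hitT; rewrite /= -/L.
by rewrite has_cat => /orP[->|->]; rewrite ?orbT.
Qed.

Lemma hclosure_not_knot closed t (T : virtual_tangle) : paint closed t T ->
  closed \/ t = Horizontal -> ~ is_knot (hclosure T).
Proof.
move=> pT split_T.
have [y [ls [colT lastT hitT]]] : exists y ls,
    [/\ colored [:: false; false] T ls, last [:: false; false] ls = [:: y; y] &
      has (fun l => true \in l) ([:: false; false] :: ls)].
  case: split_T pT => [->|->] pT.
    have [|ls [? ? hit]] := pT false false false false true; first by case: (t).
    by exists false, ls; split=> //; apply: hit.
  have [//|ls [? lastT _]] := pT false false true true true.
  exists true, ls; split=> //; apply/hasP; exists [:: true; true] => //.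
  by rewrite -lastT mem_last.
apply: (@colored_not_knot _ ([:: [:: false; false]] ++ ls ++ [:: [::]])).
  split; first exact: (ColoredCap [::] false [::]).
  apply: colored_cat colT _; rewrite lastT.
  by split=> //; apply: (ColoredCup [::] y [::]).
by case=> //=; rewrite has_cat; move: hitT => /= ->.
Qed.

Lemma hclosure_eqv S T : eqv 2 S T -> eqv 0 (hclosure_slices S) (hclosure_slices T).
Proof. by move=> ST; rewrite_word [:: (0, Cap)] 0 [:: (0, Cup)] ST. Qed.

Lemma vclosure_eqv S T : eqv 2 S T -> eqv 0 (vclosure_slices S) (vclosure_slices T).
Proof. by move=> ST; rewrite_word [:: (0, Cap); (2, Cap)] 1 [:: (2, Cup); (0, Cup)] ST. Qed.

Theorem corollary2p8 (T : virtual_tangle) (K : diagram 0 0) :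
  algebraic T ->
  K = vclosure T \/ K = hclosure T ->
  is_knot K ->
  wink_equivalent K unknot.
Proof.
move=> /algebraic_normal[t [closed [pT nT]]] [->|->] knot; apply: eqv_wink_equivalent.
- have not_split : ~ (closed \/ t = Vertical).
    by move=> split_T; apply: vclosure_not_knot pT split_T knot.
  case: nT => [c|nT]; first by case: not_split; left.
  have [|cs _ e] := normal_turn nT; first by move=> tV; apply: not_split; right.
  apply: eqv_trans (vclosure_eqv e) _.
  exact: eqv_trans (vclosure_turn (braid_width cs)) (hclosure_braid cs).
- have not_split : ~ (closed \/ t = Horizontal).
    by move=> split_T; apply: hclosure_not_knot pT split_T knot.
  case: nT => [c|nT]; first by case: not_split; left.
  have [|cs _ e] := normal_braid nT; first by move=> tH; apply: not_split; right.
  exact: eqv_trans (hclosure_eqv e) (hclosure_braid cs).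
Qed.
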